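(* Let $T,S:U\to U$ be diffeomorphisms of an open set $U\subseteq\mathbb{R}^n$, let $\mu\in\mathscr{P}(U)$ be $T$-invariant and $\nu\in\mathscr{P}(U)$ be $S$-invariant, and suppose $\operatorname{supp}(\mu),\operatorname{supp}(\nu)\subseteq U$ are compact. Let $m\in\mathbb{N}$ satisfy $m>2\max\{d_\mu,d_\nu\}$, where $d_\mu=\operatorname{boxdim}(\operatorname{supp}(\mu))$ and $d_\nu=\operatorname{boxdim}(\operatorname{supp}(\nu))$. Assume that the periodic point condition (P) of the context, with parameter $m$, holds for $T$ on $A=\operatorname{supp}(\mu)$ and for $S$ on $A=\operatorname{supp}(\nu)$. Then for almost every $y\in C^1(U,\mathbb{R})$ (in the sense of prevalence) the following implication holds: if $$\hat\mu^{(m+1)}_{(y,T)}=\hat\nu^{(m+1)}_{(y,S)},$$ then $T|_{\operatorname{supp}(\mu)}$ and $S|_{\operatorname{supp}(\nu)}$ are topologically conjugate.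
   Context: $\mathscr{P}(U)$ is the set of Borel probability measures on $U$. The pushforward of $\mu$ under a measurable $f$ is $(f\#\mu)(B):=\mu(f^{-1}(B))$; $\mu$ is $T$-invariant if $T\#\mu=\mu$. $\operatorname{supp}(\mu)$ is the smallest closed set of full $\mu$-measure. Delay map: for $y:U\to\mathbb{R}$ and $k\in\mathbb{N}$, $\Psi^{(k)}_{(y,T)}(x):=(y(x),y(T(x)),\dots,y(T^{k-1}(x)))\in\mathbb{R}^k$. The delay-coordinate invariant measure is $\hat\mu^{(k)}_{(y,T)}:=\Psi^{(k)}_{(y,T)}\#\mu\in\mathscr{P}(\mathbb{R}^k)$, and likewise $\hat\nu^{(k)}_{(y,S)}:=\Psi^{(k)}_{(y,S)}\#\nu$. Box-counting dimension of a compact $A\subseteq\mathbb{R}^n$: $\operatorname{boxdim}(A):=\lim_{\varepsilon\to0}\frac{\log N(\varepsilon)}{\log(1/\varepsilon)}$, where $N(\varepsilon)$ is the number of boxes of side-length $\varepsilon$ required to cover $A$. Periodic point condition (P) for a diffeomorphism $T$ of $U$, a compact set $A\subseteq U$ and $m\in\mathbb{N}$: for each integer $1\le p\le m$, (1) the set $A_p\subseteq A$ of $p$-periodic points (points $x\in A$ with $T^p(x)=x$) satisfies $\operatorname{boxdim}(A_p)<p/2$; (2) the linearization $DT^p$ (the derivative of the $p$-fold composition $T^p$) of each such periodic orbit has distinct eigenvalues. Topological conjugacy: $f:X\to X$ and $g:Y\to Y$ are topologically conjugate if there is a homeomorphism $h:X\to Y$ with $g=h\circ f\circ h^{-1}$.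 Prevalence: a Borel subset $G$ of a completely metrizable topological vector space $V$ is prevalent if there is a finite-dimensional subspace $E\subseteq V$ (a probe space) such that for each $v\in V$ one has $v+e\in G$ for Lebesgue almost every $e\in E$ (Lebesgue measure on $E$ via coordinates in a basis). A property holds for almost every $y\in V$ if it holds for all $y$ in a prevalent set. $C^1(U,\mathbb{R})$ carries the usual topology of uniform convergence of functions and first derivatives on compact subsets of $U$. *)

(* Defs.v *)
From HB Require Import structures.
From mathcomp Require Import all_boot all_order all_algebra.
From mathcomp Require Import complex.
From mathcomp Require Import all_classical all_reals all_analysis.

Set Implicit Arguments.
Unset Strict Implicit.
Unset Printing Implicit Defensive.

Import Order.TTheory GRing.Theory Num.Theory.
Import numFieldNormedType.Exports.

Local Open Scope classical_set_scope.
Local Open Scope ring_scope.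

(* Self-maps of a set U are encoded as total maps on R^n; every notion below
   only depends on their restriction to U. *)

(* In finite dimension, continuity of x |-> Df(x) amounts to continuity of
   x |-> Df(x) v for every v. *)
Definition C1_on (R : realType) (n : nat) (W : normedModType R)
    (U : set 'rV[R]_n) (f : 'rV[R]_n -> W) : Prop :=
  (forall x, U x -> differentiable f x) /\
  (forall v : 'rV[R]_n, {within U, continuous (fun x => 'D_v f x)}).

Definition diffeomorphism (R : realType) (n : nat) (U : set 'rV[R]_n)
    (T : 'rV[R]_n -> 'rV[R]_n) : Prop :=
  exists T' : 'rV[R]_n -> 'rV[R]_n,
    [/\ set_fun U U T /\ set_fun U U T',
        forall x, U x -> T' (T x) = x,
        forall x, U x -> T (T' x) = x,
        C1_on U T
      & C1_on U T'].

(* [C1 U] is C^1(U, R): a C^1 function on U is represented by its extension by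
   0 to R^n, so that equality in [C1 U] is equality on U. *)
Definition C1_pred (R : realType) (n : nat) (U : set 'rV[R]_n) :
    {pred 'rV[R]_n -> R} :=
  fun f => `[< C1_on U f /\ (forall x, ~ U x -> f x = 0) >].

Lemma C1_submod_closed (R : realType) (n : nat) (U : set 'rV[R]_n) :
  submod_closed (C1_pred U).
Proof.
split.
  apply/asboolP; split=> //; split=> [x _|v]; first exact: differentiable_cst.
  have -> : (fun x : 'rV[R]_n => 'D_v (0 : 'rV[R]_n -> R) x) = cst 0.
    by apply/funext => x; exact: derive_cst.
  by apply: continuous_subspaceT => x; exact: cst_continuous.
move=> a f g /asboolP[[fD fC] f0] /asboolP[[gD gC] g0]; apply/asboolP; split.
  split=> [x Ux|v].
    by apply: differentiableD; [apply: differentiableZ; exact: fD|exact: gD].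
  apply: (@subspace_eq_continuous _ _ _
    (fun x => a *: 'D_v f x + 'D_v g x)).
    move=> x /set_mem Ux.
    have fDv : derivable f x v by apply/diff_derivable/fD.
    have gDv : derivable g x v by apply/diff_derivable/gD.
    apply/esym; transitivity ('D_v (a *: f) x + 'D_v g x); last first.
      by rewrite deriveZ.
    by apply: deriveD => //; exact: derivableZ.
  by move=> x; apply: cvgD; [apply: cvgZr; exact: fC|exact: gC].
move=> x nUx; have -> : (a *: f + g) x = a *: f x + g x by [].
by rewrite f0// g0// scaler0 addr0.
Qed.

HB.instance Definition _ (R : realType) (n : nat) (U : set 'rV[R]_n) :=
  GRing.isSubmodClosed.Build R ('rV[R]_n -> R) (C1_pred U)
    (C1_submod_closed U).

Record C1 (R : realType) (n : nat) (U : set 'rV[R]_n) := MkC1 {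
  C1_val :> 'rV[R]_n -> R;
  C1_valP : C1_val \in C1_pred U }.

HB.instance Definition _ (R : realType) (n : nat) (U : set 'rV[R]_n) :=
  [isSub for @C1_val R n U].
HB.instance Definition _ (R : realType) (n : nat) (U : set 'rV[R]_n) :=
  [Choice of C1 U by <:].
HB.instance Definition _ (R : realType) (n : nat) (U : set 'rV[R]_n) :=
  [SubChoice_isSubLmodule of C1 U by <:].

Definition gradient (R : realType) (n : nat) (f : 'rV[R]_n -> R)
    (x : 'rV[R]_n) : 'rV[R]_n :=
  \row_i 'D_(delta_mx ord0 i) f x.

(* The 1-jet of a C^1 function, in the space of pairs of maps with the topology
   of uniform convergence on the compact subsets of U. *)
Definition C1_jet (R : realType) (n : nat) (U : set 'rV[R]_n) (f : C1 U) :
    {family compactly_in U, 'rV[R]_n -> R} *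
    {family compactly_in U, 'rV[R]_n -> 'rV[R]_n} :=
  (C1_val f, gradient f).

HB.instance Definition _ (R : realType) (n : nat) (U : set 'rV[R]_n) :=
  Topological.copy (C1 U) (initial_topology (@C1_jet R n U)).

Definition box (R : realType) (d : nat) (a b : 'rV[R]_d) : set 'rV[R]_d :=
  [set x | forall i, a ord0 i <= x ord0 i <= b ord0 i].

(* Countable covers are indexed by arbitrary subsets D of nat, so that the
   empty cover is allowed; this matters only for d = 0. *)
Definition lebesgue_null (R : realType) (d : nat) (N : set 'rV[R]_d) : Prop :=
  forall eps : R, 0 < eps ->
  exists (D : set nat) (a b : nat -> 'rV[R]_d),
    [/\ forall k i, a k ord0 i <= b k ord0 i,
        N `<=` \bigcup_(k in D) box (a k) (b k)
      & (\esum_(k in D) (\prod_i (b k ord0 i - a k ord0 i))%:E <= eps%:E)%E].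

(* The probe space is the span of the linearly independent family e, with the
   Lebesgue measure of the coordinates in e. *)
Definition prevalent (R : realType) (V : preTopologicalLmodType R)
    (G : set V) : Prop :=
  <<s open >> G /\
  exists (d : nat) (e : 'I_d -> V),
    (forall t : 'rV[R]_d, \sum_i t ord0 i *: e i = 0 -> t = 0) /\
    (forall v : V,
      lebesgue_null [set t : 'rV[R]_d | ~ G (v + \sum_i t ord0 i *: e i)]).

Definition almost_every (R : realType) (V : preTopologicalLmodType R)
    (P : V -> Prop) : Prop :=
  exists2 G : set V, prevalent G & forall v, G v -> P v.

Notation borelType R n := (g_sigma_algebraType (@open 'rV[R]_n)).

(* A Borel probability measure on U is encoded as a Borel probability measure
   on R^n giving mass 1 to U; [pushforward_on] is the image measure by a map
   defined on U. *)
Definition pushforward_on (R : realType) (n k : nat) (U : set 'rV[R]_n)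
    (mu : set 'rV[R]_n -> \bar R) (f : 'rV[R]_n -> 'rV[R]_k) :
    set 'rV[R]_k -> \bar R :=
  fun B => mu (U `&` f @^-1` B).

Definition eq_borel (R : realType) (k : nat)
    (mu nu : set 'rV[R]_k -> \bar R) : Prop :=
  forall B : set (borelType R k), measurable B -> mu B = nu B.

Definition invariant_measure (R : realType) (n : nat) (U : set 'rV[R]_n)
    (T : 'rV[R]_n -> 'rV[R]_n) (mu : set 'rV[R]_n -> \bar R) : Prop :=
  eq_borel (pushforward_on U mu T) mu.

Definition supp (R : realType) (n : nat) (mu : set 'rV[R]_n -> \bar R) :
    set 'rV[R]_n :=
  \bigcap_(C in [set C | closed C /\ mu (~` C) = 0%E]) C.

Definition delay_map (R : realType) (n k : nat) (y : 'rV[R]_n -> R)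
    (T : 'rV[R]_n -> 'rV[R]_n) (x : 'rV[R]_n) : 'rV[R]_k :=
  \row_(i < k) y (iter i T x).

Definition delay_measure (R : realType) (n k : nat) (U : set 'rV[R]_n)
    (mu : set 'rV[R]_n -> \bar R) (y : 'rV[R]_n -> R)
    (T : 'rV[R]_n -> 'rV[R]_n) : set 'rV[R]_k -> \bar R :=
  pushforward_on U mu (delay_map k y T).
Arguments delay_measure {R n} k U mu y T.

(* The least number of closed cubes of side eps covering A (for bounded A). *)
Definition covering_number (R : realType) (n : nat) (A : set 'rV[R]_n)
    (eps : R) : R :=
  inf [set k%:R | k in [set k : nat | exists c : 'I_k -> 'rV[R]_n,
         A `<=` \bigcup_i box (c i) (c i + const_mx eps)]].

(* The limit defining boxdim A exists and equals d. Since ln 0 = 0, the empty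
   set has dimension 0. *)
Definition has_boxdim (R : realType) (n : nat) (A : set 'rV[R]_n) (d : R) :
    Prop :=
  ln (covering_number A eps) / ln (eps^-1) @[eps --> 0^'+] --> d.

(* M has n distinct complex eigenvalues. *)
Definition distinct_eigenvalues (R : realType) (n : nat) (M : 'M[R]_n) :
    Prop :=
  exists s : n.-tuple R[i],
    uniq s /\ forall a, a \in s -> eigenvalue (map_mx (real_complex R) M) a.

Definition periodic_points (R : realType) (n : nat)
    (T : 'rV[R]_n -> 'rV[R]_n) (A : set 'rV[R]_n) (p : nat) :
    set 'rV[R]_n :=
  [set x | A x /\ iter p T x = x].

Definition periodic_point_condition (R : realType) (n : nat)
    (T : 'rV[R]_n -> 'rV[R]_n) (A : set 'rV[R]_n) (m : nat) : Prop :=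
  forall p : nat, (1 <= p <= m)%N ->
    (exists2 d : R, has_boxdim (periodic_points T A p) d & d < p%:R / 2) /\
    (forall x, periodic_points T A p x ->
      distinct_eigenvalues (jacobian (iter p T) x)).

(* f restricts to a self-map of X, g to a self-map of Y, and the restrictions
   are conjugate by the homeomorphism h with inverse h'. *)
Definition topologically_conjugate (R : realType) (n : nat)
    (X : set 'rV[R]_n) (f : 'rV[R]_n -> 'rV[R]_n)
    (Y : set 'rV[R]_n) (g : 'rV[R]_n -> 'rV[R]_n) : Prop :=
  (set_fun X X f /\ set_fun Y Y g) /\
  exists h h' : 'rV[R]_n -> 'rV[R]_n,
    [/\ [/\ set_fun X Y h, set_fun Y X h',
            forall x, X x -> h' (h x) = x & forall y, Y y -> h (h' y) = y],
        {within X, continuous h},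
        {within Y, continuous h'}
      & forall y, Y y -> g y = h (f (h' y))].

(* Main.v *)
(** A delay map that is injective on the support suffices: equality of the
    (m+1)-delay measures gives equality of the images of the two supports under
    the (m+1)-delay maps; forgetting the last coordinate gives a bijection h of
    the supports, forgetting the first one gives h o T = S o h, and compactness
    makes h bicontinuous.

    Injectivity of the m-delay map for almost every y is a box-counting
    argument.  The probe consists of the polynomials of degree at most 2m in
    each variable, which interpolate arbitrary values at 2m points.  For a pair
    x <> z, the m differences y(T^i x) - y(T^i z) are affine in the coefficients
    t of the probe, with a matrix whose rank is at least half the number of
    points of the two orbit segments (and equals m if the segments are disjoint
    and one of them has no repetition).  The t for which some pair in a given
    family has all its differences zero form a null set as soon as this rank
    exceeds the box dimension of the family: A x A in the general case, A_p x
    A_q for two short periodic orbits, a Lipschitz image of A or A_p if the two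
    points lie on the same orbit. *)

Require Import Defs.
From HB Require Import structures.
From mathcomp Require Import all_boot all_order all_algebra.
From mathcomp Require Import ring lra zify.
From mathcomp Require Import all_classical all_reals all_analysis.

Set Implicit Arguments.
Unset Strict Implicit.
Unset Printing Implicit Defensive.

Import Order.TTheory GRing.Theory Num.Theory.
Import numFieldNormedType.Exports.

Local Open Scope classical_set_scope.
Local Open Scope ring_scope.

(** * Lebesgue null sets *)

Lemma lebesgue_null_sub (R : realType) (d : nat) (A B : set 'rV[R]_d) :
  A `<=` B -> lebesgue_null B -> lebesgue_null A.
Proof.
move=> AB nB eps /nB[D [a [b [ab Bab vol]]]].
by exists D, a, b; split => //; exact: subset_trans Bab.
Qed.

(** The [i]-th set gets a cover of volume at most [eps / 2 ^ (pickle i).+1], and the resulting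
    double family of boxes is reindexed by naturals through [pickle]. *)
Lemma lebesgue_null_bigcup (R : realType) (d : nat) (I : countType)
    (N : I -> set 'rV[R]_d) :
  (forall i, lebesgue_null (N i)) -> lebesgue_null (\bigcup_i N i).
Proof.
move=> nullN eps eps0.
have epsI (i : I) : 0 < eps / (2 ^ (pickle i).+1)%:R.
  by rewrite divr_gt0// ltr0n expn_gt0.
have /choice[D_] (i : I) := nullN i _ (epsI i).
move=> /choice[a_] /choice[b_] Dab.
pose J := [set: I] `*`` D_.
(* Indices that encode no pair get a degenerate box, since the ordering of the corners is required
   at every index. *)
pose c (k : nat) : 'rV[R]_d * 'rV[R]_d :=
  if unpickle k is Some (i, j) then (a_ i j, b_ i j) else (0, 0).
have cE (k : I * nat) : c (pickle k) = (a_ k.1 k.2, b_ k.1 k.2).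
  by rewrite /c pickleK; case: k.
exists (pickle @` J), (fst \o c), (snd \o c); split.
- move=> k i /=; rewrite /c; case: unpickle => [[i' j]|] /=.
    by have [+ _ _] := Dab i'; apply.
  by rewrite mxE.
- move=> t [i _ Nit]; have [_ /(_ _ Nit)[j Dj tj] _] := Dab i.
  by exists (pickle (i, j)); [exists (i, j)|rewrite /= cE].
- rewrite esum_image; last by move=> x y _ _; exact: pcan_inj (@pickleK _) x y.
  under eq_esum do rewrite /= cE /=.
  have vol_ge0 (i : I) j : (0 <= (\prod_l (b_ i j ord0 l - a_ i j ord0 l))%:E)%E.
    rewrite lee_fin prodr_ge0// => l _.
    by have [+ _ _] := Dab i; rewrite subr_ge0; apply.
  rewrite -(esum_esum (a := fun i j =>
    (\prod_l (b_ i j ord0 l - a_ i j ord0 l))%:E)) //.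
  apply: (@le_trans _ _
    (\esum_(i in [set: I]) (eps / (2 ^ (pickle i).+1)%:R)%:E)).
    by apply: le_esum => i _; have [] := Dab i.
  rewrite -(esum_image [set: I] pickle (fun k => (eps / (2 ^ k.+1)%:R)%:E));
    last by move=> x y _ _; exact: pcan_inj (@pickleK _) x y.
  apply: (le_trans _ (epsilon_trick0 xpredT (ltW eps0))).
  rewrite nneseries_esumT; last by move=> k; rewrite lee_fin divr_ge0// ltW.
  rewrite esum_mkcond; apply: le_esum => k _.
  by case: ifPn => //; rewrite lee_fin divr_ge0// ltW.
Qed.

Lemma lebesgue_nullU (R : realType) (d : nat) (A B : set 'rV[R]_d) :
  lebesgue_null A -> lebesgue_null B -> lebesgue_null (A `|` B).
Proof.
move=> nA nB; apply: (@lebesgue_null_sub _ _ _ (\bigcup_b if b then A else B)).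
  by move=> t [At|Bt]; [exists true|exists false].
by apply: lebesgue_null_bigcup => -[].
Qed.

(** This is the form in which null sets arise below: finitely many cubes of one side length, so that
    the volume is a count times a power. *)
Lemma lebesgue_null_cubes (R : realType) (d : nat) (A : set 'rV[R]_d) :
  (forall eps, 0 < eps -> exists (s : R) (c : seq 'rV[R]_d), [/\ 0 <= s,
    (size c)%:R * s ^+ d <= eps &
    forall t, A t -> exists2 x, x \in c & box x (x + const_mx s) t]) ->
  lebesgue_null A.
Proof.
move=> cubes eps /cubes[s [c [s0 vol Ac]]].
exists `I_(size c), (nth 0 c), (fun k => nth 0 c k + const_mx s); split.
- by move=> k i; rewrite !mxE lerDl.
- move=> t /Ac[x xc xt]; exists (index x c); first by rewrite /= index_mem.
  by rewrite nth_index.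
- under eq_esum => k _.
    under eq_bigr do rewrite !mxE [X in X - _]addrC addrK.
    rewrite big_const_ord iter_mulr_1; over.
  rewrite esum_fset//; last by move=> *; rewrite lee_fin exprn_ge0.
  rewrite -fsbig_ord/= sumEFin lee_fin sumr_const card_ord.
  by rewrite -[s ^+ d *+ _]mulr_natl.
Qed.

(** * Norm estimates for matrices *)

Lemma ler_mx_norm (R : realType) (p q : nat) (A : 'M[R]_(p, q)) i j :
  `|A i j| <= `|A|.
Proof.
rewrite [leRHS]/Num.norm/= mx_normrE.
by apply/bigmax_geP; right => /=; exists (i, j).
Qed.

Lemma mx_norm_le (R : realType) (p q : nat) (A : 'M[R]_(p, q)) (c : R) :
  0 <= c -> (forall i j, `|A i j| <= c) -> `|A| <= c.
Proof.
move=> c0 Ac; rewrite [leLHS]/Num.norm/= mx_normrE.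
by apply/bigmax_leP; split => // -[i j] _; exact: Ac.
Qed.

Lemma ler_norm_sum_const (R : realType) (q : nat) (P : pred 'I_q)
    (F : 'I_q -> R) (c : R) :
  0 <= c -> (forall i, P i -> `|F i| <= c) ->
  `|\sum_(i | P i) F i| <= q%:R * c.
Proof.
move=> c0 Fc; apply: (le_trans (ler_norm_sum _ _ _)).
apply: (@le_trans _ _ (\sum_(i < q) c)).
  rewrite [leLHS]big_mkcond/=; apply: ler_sum => i _.
  by case: ifP => // /Fc.
by rewrite sumr_const card_ord mulr_natl.
Qed.

Lemma ler_norm_mulmx (R : realType) (p q r : nat) (A : 'M[R]_(p, q))
    (B : 'M[R]_(q, r)) : `|A *m B| <= q%:R * (`|A| * `|B|).
Proof.
apply: mx_norm_le => [|i j]; first by rewrite !mulr_ge0.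
rewrite mxE; apply: ler_norm_sum_const => [|l _].
  by rewrite mulr_ge0.
by rewrite normrM ler_pM// ler_mx_norm.
Qed.

(** The coordinates of [u] along [g] solve a linear system with matrix the minor [mxsub g f A],
    whose right-hand side is [u *m A] minus the contribution of the other coordinates. Multiplying
    by the inverse [N] bounds them by a constant depending only on sizes and on [k], [c]. *)
Lemma slab_coord_bound (R : realType) (D m r : nat) (A : 'M[R]_(D, m))
    (f : 'I_r -> 'I_m) (g : 'I_r -> 'I_D) (N : 'M[R]_r) (u : 'rV[R]_D)
    (k c e : R) :
  injective g -> mxsub g f A *m N = 1%:M -> 1 <= k -> `|A| <= k -> `|N| <= k ->
  0 <= c -> 0 <= e ->
  (forall j, j \notin codom g -> `|u ord0 j| <= e) ->
  `|u *m A| <= c * e ->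
  `|u| <= (1 + r%:R * (k * (c + D%:R * k))) * e.
Proof.
move=> ginj AN k1 Ak Nk c0 e0 uout uA.
have k0 : 0 <= k by apply: le_trans k1.
have bound_ge : e <= (1 + r%:R * (k * (c + D%:R * k))) * e.
  by rewrite ler_peMl// lerDl !mulr_ge0// addr_ge0// mulr_ge0.
apply: mx_norm_le => [|i j]; first exact: le_trans bound_ge.
rewrite (ord1 i); have [|/uout/le_trans] := boolP (j \in codom g); last exact.
case/codomP => a {j}->.
pose v : 'rV[R]_r := \row_b u ord0 (g b).
have vA b : `|(v *m mxsub g f A) ord0 b| <= c * e + D%:R * (k * e).
  have -> : (v *m mxsub g f A) ord0 b =
      (u *m A) ord0 (f b) - \sum_(j | j \notin codom g) u ord0 j * A j (f b).
    rewrite !mxE (bigID (mem (codom g)))/= addrK.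
    rewrite -big_uniq/=; last by rewrite map_inj_uniq// enum_uniq.
    by rewrite big_image; apply: eq_bigr => c' _; rewrite !mxE.
  apply: (le_trans (ler_normB _ _)); apply: lerD.
    exact: le_trans (ler_mx_norm _ _ _) uA.
  apply: ler_norm_sum_const => [|j jg].
    by rewrite mulr_ge0.
  by rewrite normrM mulrC ler_pM ?uout// (le_trans (ler_mx_norm _ _ _)).
have -> : u ord0 (g a) = (v *m (mxsub g f A *m N)) ord0 a.
  by rewrite AN mulmx1 mxE.
rewrite mulmxA mxE.
have -> : (1 + r%:R * (k * (c + D%:R * k))) * e =
    e + r%:R * ((c * e + D%:R * (k * e)) * k) by ring.
apply: (@le_trans _ _ (r%:R * ((c * e + D%:R * (k * e)) * k))); last first.
  by rewrite lerDr.
apply: ler_norm_sum_const => [|b _].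
  by rewrite mulr_ge0// addr_ge0// !mulr_ge0.
by rewrite normrM ler_pM// (le_trans (ler_mx_norm _ _ _)).
Qed.

(** * Zero sets of parametrized affine maps *)

(** Essentially an upper box dimension at most [s], with pieces of any shape. The constant [C] sits
    on the diameters and not on the count, so that Lipschitz images keep the same [s]. *)
Definition coverable (R : realType) (V : normedModType R) (P : set V) (s : R) :=
  exists2 C : R, 0 <= C & \forall e \near 0^'+,
    exists (k : nat) (f : 'I_k -> set V), [/\ k%:R <= e `^ (- s),
      P `<=` \bigcup_i f i &
      forall i q q', f i q -> f i q' -> `|q - q'| <= C * e].

Definition lipschitz_on (R : realType) (V W : normedModType R) (A : set V)
    (f : V -> W) :=
  exists2 C : R, 0 <= C & forall x y, A x -> A y -> `|f x - f y| <= C * `|x - y|.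

(** The shift by [k] makes the arguments nonnegative, where [Num.truncn] is the floor. *)
Lemma grid_cell_near (R : realType) (k e x y : R) : 0 < e -> - k <= x -> - k <= y ->
  Num.truncn ((x + k) / e) = Num.truncn ((y + k) / e) -> `|x - y| <= e.
Proof.
move=> e0 xk yk xy.
have xe : 0 <= (x + k) / e by apply: divr_ge0; [lra|exact: ltW].
have ye : 0 <= (y + k) / e by apply: divr_ge0; [lra|exact: ltW].
have := truncn_itv xe; have := truncn_itv ye; rewrite xy => /andP[y1 y2] /andP[x1 x2].
have -> : x - y = e * ((x + k) / e - (y + k) / e).
  by field; rewrite gt_eqF.
rewrite normrM gtr0_norm// ler_piMr ?(ltW e0)// ler_norml.
rewrite -natr1 in x2 y2.
by apply/andP; split; lra.
Qed.

Section zero_set.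
Variables (R : realType) (V : normedModType R) (D m : nat).
Variables (P : set V) (M : V -> 'M[R]_(D, m)) (b : V -> 'rV[R]_m) (s : R).
Hypotheses (Mlip : lipschitz_on P M) (blip : lipschitz_on P b).
Hypothesis Pcov : coverable P s.

(* Bounding the inverse of an invertible minor of M q makes the estimates below
   uniform in q. *)
Let bad (r : nat) (f : 'I_r -> 'I_m) (g : 'I_r -> 'I_D) (k : R) (q : V) :
    set 'rV[R]_D :=
  [set t | [/\ P q, t *m M q + b q = 0,
      exists2 N : 'M[R]_r, mxsub g f (M q) *m N = 1%:M & `|N| <= k,
      `|M q| <= k & `|t| <= k]].

(** Subtracting the two equations gives [(t - t') *m M q = (b q' - b q) + t' *m (M q' - M q)], which
    is of order [e] by the Lipschitz bounds and [|t'| <= k]. The minor then controls the coordinates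
    along [g]. [K] is chosen before [C] and [e]. *)
Lemma bad_close (r : nat) (f : 'I_r -> 'I_m) (g : 'I_r -> 'I_D) (k : R) :
  injective g -> 1 <= k -> exists2 K : R, 0 <= K & forall (C e : R) q q' t t',
    0 <= C -> 0 <= e -> `|q - q'| <= C * e ->
    bad f g k q t -> bad f g k q' t' ->
    (forall j, j \notin codom g -> `|t ord0 j - t' ord0 j| <= e) ->
    `|t - t'| <= (K * (1 + C)) * e.
Proof.
move=> ginj k1; have [[KM KM0 KMP] [Kb Kb0 KbP]] := (Mlip, blip).
have k0 : 0 <= k by apply: le_trans k1.
pose L := Kb + D%:R * (k * KM).
have L0 : 0 <= L by rewrite addr_ge0// !mulr_ge0.
exists (1 + r%:R * (k * (L + D%:R * k))).
  by rewrite addr_ge0// !mulr_ge0// addr_ge0// mulr_ge0.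
move=> C e q q' t t' C0 e0 qq' [Pq tq [N MN Nk] Mk tk] [Pq' tq' _ _ tk'] tt'.
have uM : `|(t - t') *m M q| <= (L * C) * e.
  have -> : (t - t') *m M q = (b q' - b q) + t' *m (M q' - M q).
    have tMq : t *m M q = - b q by apply/eqP; rewrite -addr_eq0 tq.
    have tMq' : t' *m M q' = - b q' by apply/eqP; rewrite -addr_eq0 tq'.
    rewrite mulmxBl mulmxBr tMq tMq'.
    by rewrite addrA [X in _ = X - _]addrAC subrr sub0r.
  apply: (le_trans (ler_normD _ _)); rewrite /L mulrDl mulrDl; apply: lerD.
    rewrite distrC -mulrA; apply: (le_trans (KbP _ _ Pq Pq')).
    by rewrite ler_wpM2l.
  apply: (le_trans (ler_norm_mulmx _ _)); rewrite -!mulrA ler_wpM2l//.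
  rewrite ler_pM//; rewrite distrC; apply: (le_trans (KMP _ _ Pq Pq')).
  by rewrite ler_wpM2l.
have /= := slab_coord_bound ginj MN k1 Mk Nk (mulr_ge0 L0 C0) e0 _ uM.
move=> /(_ _)/le_trans; apply.
  by move=> j jg; rewrite !mxE tt'.
rewrite ler_wpM2r// -subr_ge0.
set d := D%:R * k; have d0 : 0 <= d by rewrite mulr_ge0.
rewrite [leRHS](_ : _ = r%:R * k * L + C + r%:R * k * d * C); last by ring.
by rewrite !addr_ge0// !mulr_ge0.
Qed.

(** Cut [P] into at most [e ^ (-s)] pieces and each of the [D - r] coordinates outside [g] into
    [O(1/e)] intervals. Each combination confines [t] to a cube of side [O(e)], so the total volume
    is [O(e ^ (r - s))], which tends to 0. *)
Lemma bad_null (r : nat) (f : 'I_r -> 'I_m) (g : 'I_r -> 'I_D) (k : R) :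
  injective g -> 1 <= k -> s < r%:R ->
  lebesgue_null (\bigcup_q bad f g k q).
Proof.
move=> ginj k1 sr; apply: lebesgue_null_cubes => eta eta0.
have [K K0 Kclose] := bad_close f ginj k1; have [C C0 Ccov] := Pcov.
pose w := K * (1 + C).
have w0 : 0 <= w by rewrite mulr_ge0// addr_ge0.
have rD : (r <= D)%N by have := leq_card g ginj; rewrite !card_ord.
(* [Z * e ^ (r - s)] bounds the total volume: [(2 * k + 1) / e] bounds the number of intervals per
   coordinate, and [2 * w * e] is the side of the cubes. *)
pose Z := (2 * k + 1) ^+ (D - r) * (2 * w) ^+ D.
have k0 : 0 <= k by apply: le_trans k1.
have Z0 : 0 <= Z by rewrite mulr_ge0// exprn_ge0// ?addr_ge0// mulr_ge0.
have [e [e0 e1 eZ [N [F [Ne PF Fe]]]]] : exists e : R, [/\ 0 < e, e <= 1,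
    Z * e `^ (r%:R - s) <= eta &
    exists (N : nat) (F : 'I_N -> set V), [/\ N%:R <= e `^ (- s),
      P `<=` \bigcup_i F i &
      forall i q q', F i q -> F i q' -> `|q - q'| <= C * e]].
  have : \forall e \near 0^'+, Z * e `^ (r%:R - s) <= eta.
    have : Z * e `^ (r%:R - s) @[e --> 0^'+] --> Z * 0.
      by apply: cvgMr; apply: powR_cvg0; rewrite subr_gt0.
    by rewrite mulr0 => /cvgr_le; apply.
  move=> nearZ; near (0:R)^'+ => e; exists e; split; near: e => //.
  - exact: nbhs_right_gt.
  - exact: nbhs_right_le.
pose G := Num.truncn (2 * k / e).
(* The coordinates along [g] are not cut, since [bad_close] determines them up to order [e]; their
   label is constantly [ord0]. *)
pose cell (t : 'rV[R]_D) : {ffun 'I_D -> 'I_G.+1} :=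
  [ffun j => if j \in codom g then ord0
             else inord (Num.truncn ((t ord0 j + k) / e))].
pose T (i : 'I_N) (c : {ffun 'I_D -> 'I_G.+1}) : set 'rV[R]_D :=
  [set t | cell t = c /\ exists2 q, F i q & bad f g k q t].
have coord (t : 'rV[R]_D) j : `|t| <= k -> - k <= t ord0 j <= k.
  by move=> tk; rewrite -ler_norml (le_trans (ler_mx_norm _ _ _)).
have Tclose i c t t' : T i c t -> T i c t' -> `|t - t'| <= w * e.
  move=> [tc [q Fq tq]] [tc' [q' Fq' tq']].
  apply: (Kclose C e q q') => //; [exact: ltW|exact: Fe Fq Fq'|].
  move=> j jg; have [[_ _ _ _ tk] [_ _ _ _ tk']] := (tq, tq').
  have /andP[tj1 tj2] := coord _ j tk; have /andP[tj1' tj2'] := coord _ j tk'.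
  apply: (@grid_cell_near _ k) => //.
  have small x : - k <= x -> x <= k -> (Num.truncn ((x + k) / e) < G.+1)%N.
    move=> x1 x2; rewrite ltnS; apply: le_truncn.
    by rewrite ler_pM2r ?invr_gt0//; lra.
  have := congr1 (fun h : {ffun _ -> _} => val (h j)) (etrans tc (esym tc')).
  by rewrite !ffunE (negbTE jg)/= !inordK ?small.
(* A cube of side [2 * w * e] centred at any point of the piece contains the piece; an empty piece
   gets the corner 0. *)
have /choice[corner cornerP] : forall ic : 'I_N * {ffun 'I_D -> 'I_G.+1},
    exists x, forall t, T ic.1 ic.2 t -> box x (x + const_mx (2 * w * e)) t.
  move=> [i c]; have [[t0 /= Tt0]|noT] := pselect (exists t, T i c t); last first.
    by exists 0 => t Tt; case: noT; exists t.
  exists (t0 - const_mx (w * e)) => t /= Tt j; rewrite !mxE.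
  have := le_trans (ler_mx_norm _ ord0 j) (Tclose _ _ _ _ Tt Tt0).
  rewrite !mxE ler_norml => /andP[h1 h2].
  by apply/andP; split; lra.
(* Only labels equal to [ord0] along [g] are listed, whence the exponent [D - r] in the count. *)
exists (2 * w * e), [seq corner (i, c) | i <- enum 'I_N,
   c <- enum (pffun_on (ord0 : 'I_G.+1) [predC codom g] predT)]; split.
- by rewrite mulr_ge0 ?(ltW e0)// mulr_ge0.
- rewrite size_allpairs size_enum_ord -cardE card_pffun_on card_ord.
  have -> : #|[predC codom g]| = (D - r)%N.
    have := cardC (mem (codom g)); rewrite card_codom// !card_ord => cardE'.
    apply: (@addnI r); rewrite subnKC//; exact: (etrans _ cardE').
  apply: le_trans eZ; rewrite natrM natrX.
  have Ge : G.+1%:R <= (2 * k + 1) / e.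
    rewrite -natr1 mulrDl; apply: lerD; last by rewrite div1r invf_ge1.
    by rewrite truncn_le divr_ge0 ?(ltW e0)// mulr_ge0.
  rewrite [X in e `^ X]addrC powRD; last by rewrite (gt_eqF e0) implybT.
  rewrite powR_mulrn ?(ltW e0)//.
  apply: (@le_trans _ _ (e `^ (- s) * ((2 * k + 1) / e) ^+ (D - r) * (2 * w * e) ^+ D)).
    apply: ler_wpM2r.
      by rewrite exprn_ge0// mulr_ge0 ?(ltW e0)// mulr_ge0.
    apply: ler_pM => //.
    by rewrite lerXn2r ?nnegrE ?ler0n// divr_ge0 ?(ltW e0)// addr_ge0// mulr_ge0.
  rewrite /Z expr_div_n [(2 * w * e) ^+ D]exprMn.
  rewrite -[in e ^+ D](subnK rD) exprD.
  set A := (2 * k + 1) ^+ _; set B := (2 * w) ^+ _.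
  have eDr : e ^+ (D - r) != 0 by rewrite expf_neq0// gt_eqF.
  rewrite le_eqVlt; apply/orP; left; apply/eqP; field.
  exact: eDr.
- move=> t [q _ tq]; have [Pq _ _ _ tk] := tq.
  have [i _ Fq] := PF _ Pq.
  exists (corner (i, cell t)); last by apply: cornerP; split => //; exists q.
  apply/allpairsP; exists (i, cell t); rewrite /= !mem_enum; split => //.
  apply/pffun_onP; split=> //; apply/fintype.subsetP => j.
  by rewrite !inE ffunE; case: ifP => //=; rewrite eqxx.
Unshelve. all: by end_near. Qed.

(** Each such [t] lies in a bad set for some invertible minor of size the rank of [M q] and some
    integer bound; there are countably many choices of minor and bound, and each bad set with
    [s < r] is null. *)
Lemma zero_set_null : (forall q, P q -> s < (\rank (M q))%:R) ->
  lebesgue_null [set t : 'rV[R]_D | exists2 q, P q & t *m M q + b q = 0].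
Proof.
move=> Prank.
pose I := ({r : nat & ({ffun 'I_r -> 'I_m} * {ffun 'I_r -> 'I_D})%type} * nat)%type.
pose B (i : I) : set 'rV[R]_D :=
  let: (existT r (f, g), k) := i in
  if `[< injective g /\ s < r%:R >] then \bigcup_q bad f g k.+1%:R q else set0.
apply: (@lebesgue_null_sub _ _ _ (\bigcup_i B i)); last first.
  apply: lebesgue_null_bigcup => -[[r [f g]] k]; rewrite /B.
  case: ifPn => [/asboolP[ginj sr]|_].
    by apply: bad_null => //; rewrite ler1n.
  apply: lebesgue_null_cubes => e e0; exists 0, [::]; split => //=.
  by rewrite mul0r ltW.
move=> t [q Pq tq].
(* A maximal free family of columns [f], then enough rows [g] of these columns, yields an invertible
   square minor. *)
have := maxrowsub_free (M q)^T.
pose f := maxrankfun (M q)^T; set r := \rank _ in f * => Mrow.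
have rE : r = \rank (M q) by rewrite /r mxrank_tr.
pose A := colsub f (M q).
have Afull : row_full A.
  by rewrite /A /row_full -mxrank_tr trmx_mxsub.
pose g := fullrankfun Afull.
have unitA : mxsub g f (M q) \in unitmx.
  by have := fullrowsub_unit Afull; rewrite /A -mxsub_comp.
pose N := invmx (mxsub g f (M q)).
pose k := Num.truncn (Num.max (`|N|) (Num.max `|M q| `|t|)).
exists (existT _ r (f, g), k) => //; rewrite /B asboolT; last first.
  by split; [exact: fullrankfun_inj|rewrite rE Prank].
have := truncnS_gt (Num.max (`|N|) (Num.max `|M q| `|t|)).
rewrite -/k !gt_max => /and3P[/ltW Nk /ltW Mk /ltW tk].
exists q => //; split => //; exists N => //; exact: mulmxV.
Qed.

End zero_set.

(** * Covering exponents of images, products and sets of known box dimension *)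

Lemma coverable_sub (R : realType) (V : normedModType R) (A B : set V) (s : R) :
  A `<=` B -> coverable B s -> coverable A s.
Proof.
move=> AB [C C0 cov]; exists C => //; near=> e.
have [k [f [ke Bf fe]]] : exists (k : nat) (f : 'I_k -> set V),
    [/\ k%:R <= e `^ (- s), B `<=` \bigcup_i f i &
      forall i q q', f i q -> f i q' -> `|q - q'| <= C * e].
  by near: e; exact: cov.
by exists k, f; split => //; exact: subset_trans Bf.
Unshelve. all: by end_near. Qed.

Lemma coverable_image (R : realType) (V W : normedModType R) (A : set V)
    (h : V -> W) (s : R) :
  lipschitz_on A h -> coverable A s -> coverable (h @` A) s.
Proof.
move=> [L L0 hL] [C C0 cov]; exists (L * C); first exact: mulr_ge0.
near=> e.
have [k [f [ke Af fe]]] : exists (k : nat) (f : 'I_k -> set V),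
    [/\ k%:R <= e `^ (- s), A `<=` \bigcup_i f i &
      forall i q q', f i q -> f i q' -> `|q - q'| <= C * e].
  by near: e; exact: cov.
exists k, (fun i => h @` (A `&` f i)); split => //.
  by move=> _ [x Ax <-]; have [i _ fx] := Af _ Ax; exists i => //; exists x.
move=> i _ _ [x [Ax fx] <-] [y [Ay fy] <-].
apply: (le_trans (hL _ _ Ax Ay)); rewrite -mulrA ler_wpM2l//.
exact: fe fx fy.
Unshelve. all: by end_near. Qed.

(** The product norm is a maximum, so products of pieces have diameter at most [Num.max C C' * e],
    and the counts multiply. *)
Lemma coverableX (R : realType) (V W : normedModType R) (A : set V) (B : set W)
    (s s' : R) :
  coverable A s -> coverable B s' -> coverable (A `*` B) (s + s').
Proof.
move=> [C C0 cov] [C' C0' cov']; exists (Num.max C C').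
  by rewrite le_max C0.
near=> e.
have e0 : 0 < e by near: e; exact: nbhs_right_gt.
have [k [f [ke Af fe]]] : exists (k : nat) (f : 'I_k -> set V),
    [/\ k%:R <= e `^ (- s), A `<=` \bigcup_i f i &
      forall i q q', f i q -> f i q' -> `|q - q'| <= C * e].
  by near: e; exact: cov.
have [k' [f' [ke' Bf fe']]] : exists (k : nat) (f : 'I_k -> set W),
    [/\ k%:R <= e `^ (- s'), B `<=` \bigcup_i f i &
      forall i q q', f i q -> f i q' -> `|q - q'| <= C' * e].
  by near: e; exact: cov'.
pose I := ('I_k * 'I_k')%type.
exists #|{: I}|, (fun i => f (enum_val i).1 `*` f' (enum_val i).2); split.
- rewrite card_prod !card_ord natrM opprD powRD ?(gt_eqF e0) ?implybT//.
  by rewrite ler_pM.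
- move=> [x y] [/Af[i _ fx] /Bf[j _ fy]]; exists (enum_rank ((i, j) : I)) => //.
  by rewrite enum_rankK.
- move=> i [x y] [x' y'] [/= fx fy] [/= fx' fy'].
  rewrite [leLHS]/Num.norm/= ge_max; apply/andP; split.
    apply: (le_trans (fe _ _ _ fx fx')).
    by rewrite ler_pM2r// le_max lexx.
  apply: (le_trans (fe' _ _ _ fy fy')).
  by rewrite ler_pM2r// le_max lexx orbT.
Unshelve. all: by end_near. Qed.

(** A finite grid on the cube of radius [M] does it; this makes the set whose infimum is
    [covering_number] nonempty. *)
Lemma box_cover (R : realType) (n : nat) (A : set 'rV[R]_n) (M e : R) :
  (forall x, A x -> `|x| <= M) -> 0 < e ->
  exists (k : nat) (c : 'I_k -> 'rV[R]_n),
    A `<=` \bigcup_i box (c i) (c i + const_mx e).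
Proof.
move=> AM e0; pose G := Num.truncn (2 * M / e).
pose I := {ffun 'I_n -> 'I_G.+1}.
exists #|{: I}|, (fun i => \row_j (e * ((enum_val i : I) j)%:R - M)) => x Ax.
exists (enum_rank ([ffun j => inord (Num.truncn ((x ord0 j + M) / e))] : I)) => //.
move=> j; rewrite !mxE enum_rankK ffunE.
have := le_trans (ler_mx_norm x ord0 j) (AM _ Ax).
rewrite ler_norml => /andP[x1 x2].
have xe : 0 <= (x ord0 j + M) / e by apply: divr_ge0; [lra|exact: ltW].
rewrite inordK; last first.
  by rewrite ltnS; apply: le_truncn; rewrite ler_pM2r ?invr_gt0//; lra.
have /andP[] := truncn_itv xe; rewrite -natr1; set t := _%:R.
rewrite ler_pdivlMr// ltr_pdivrMr// => h1 h2.
by apply/andP; split; lra.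
Qed.

(** The gap [d < s] gives [ln N / ln (1/e) < s] for all small [e], hence [N <= e ^ (-s)] with no
    constant in front. Cubes of side [e] have diameter at most [e] in the sup norm. *)
Lemma has_boxdim_coverable (R : realType) (n : nat) (A : set 'rV[R]_n)
    (M d s : R) :
  (forall x, A x -> `|x| <= M) -> has_boxdim A d -> d < s -> coverable A s.
Proof.
move=> AM Ad ds; exists 1 => //; near=> e.
have e0 : 0 < e by near: e; exact: nbhs_right_gt.
have e1 : e < 1 by near: e; exact: nbhs_right_lt.
have Ne : ln (covering_number A e) / ln e^-1 < s.
  by near: e; apply: (cvgr_lt d Ad).
have ln_gt0 : 0 < ln e^-1 by rewrite ln_gt0// invf_gt1.
have {}Ne : covering_number A e <= e `^ (- s).
  (* A covering number that is not positive is treated apart, because the comparison of logarithms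
     needs positive arguments. *)
  have [N0|N0] := ltP 0 (covering_number A e); last first.
    exact: le_trans N0 (powR_ge0 _ _).
  rewrite -ler_ln ?posrE ?powR_gt0// ln_powR mulNr -mulrN -lnV ?posrE//.
  by rewrite -ler_pdivrMr// ltW.
pose good k := `[< exists c : 'I_k -> 'rV[R]_n,
  A `<=` \bigcup_i box (c i) (c i + const_mx e) >].
have exgood : exists k, good k.
  by have [k [c Ac]] := box_cover AM e0; exists k; apply/asboolP; exists c.
(* The least admissible count is below every element of the set, hence below its infimum. *)
case: (ex_minnP exgood) => k /asboolP[c Ac] kmin.
exists k, (fun i => box (c i) (c i + const_mx e)); split => //.
  apply: le_trans Ne; apply: lb_le_inf; first by exists k%:R, k => //; exists c.
  by move=> _ [k' ck' <-]; rewrite ler_nat; apply: kmin; exact/asboolP.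
move=> i x y xi yi; rewrite mul1r; apply: mx_norm_le => [|a j]; first exact: ltW.
rewrite (ord1 a) !mxE ler_norml.
have := xi j; have := yi j; rewrite !mxE => /andP[h1 h2] /andP[h3 h4].
by apply/andP; split; lra.
Unshelve. all: by end_near. Qed.

(** * C^1 functions are Lipschitz on compact sets *)

Lemma is_derive_line (R : realType) (n : nat) (f : 'rV[R]_n -> R)
    (x w : 'rV[R]_n) (t : R) :
  derivable f (t *: w + x) w ->
  is_derive t 1 (fun t : R => f (t *: w + x)) ('D_w f (t *: w + x)).
Proof.
have E : (fun h : R => h^-1 *: (f ((h *: 1 + t) *: w + x) - f (t *: w + x))) =
         (fun h : R => h^-1 *: (f (h *: w + (t *: w + x)) - f (t *: w + x))).
  by apply/funext => h; rewrite [h *: 1]mulr1 scalerDl addrA.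
by move=> fw; split; rewrite /derivable/derive/= E.
Qed.

Lemma derive_sum_basis (R : realType) (n : nat) (f : 'rV[R]_n -> R)
    (x w : 'rV[R]_n) : differentiable f x ->
  'D_w f x = \sum_i w ord0 i * 'D_(delta_mx ord0 i) f x.
Proof.
move=> fx; rewrite deriveE// [in LHS](row_sum_delta w) linear_sum.
by apply: eq_bigr => i _; rewrite linearZ/= deriveE.
Qed.

(** On a small ball the partial derivatives are bounded by [B]; the mean value theorem along a
    segment of the ball gives the constant [n * B]. *)
Lemma C1_locally_lipschitz (R : realType) (n : nat) (U : set 'rV[R]_n)
    (f : 'rV[R]_n -> R) (x0 : 'rV[R]_n) :
  open U -> C1_on U f -> U x0 ->
  exists2 C : R, 0 <= C & exists2 r : R, 0 < r & forall x y,
    ball x0 r x -> ball x0 r y -> `|f x - f y| <= C * `|x - y|.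
Proof.
move=> oU [fd fc] Ux0.
(* The summand 1 makes [B] strictly larger than each partial derivative at [x0], so the bound
   persists nearby. *)
pose B := 1 + \sum_i `|'D_(delta_mx ord0 i) f x0|.
have B0 : 0 <= B by rewrite addr_ge0// sumr_ge0.
have nearB : \forall z \near x0, U z /\
    forall i, `|'D_(delta_mx ord0 i) f z| <= B.
  near=> z; split; first by near: z; exact: open_nbhs_nbhs.
  near: z; apply: filter_forall => i.
  have := fc (delta_mx ord0 i).
  rewrite (continuous_open_subspace _ oU) => /(_ x0 (mem_set Ux0)) /cvg_norm/cvgr_le; apply.
  rewrite /B (bigD1 i)//= addrCA ltrDl ltr_pwDl// sumr_ge0//.
have [r /= r0 Br] := (nbhs_ballP _ _).1 nearB.
exists (n%:R * B); first exact: mulr_ge0.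
exists r => // x y xr yr.
have seg (t : R) : 0 <= t <= 1 -> ball x0 r (t *: (x - y) + y).
  move=> /andP[t0 t1]; rewrite -ball_normE/= in xr yr *.
  have -> : x0 - (t *: (x - y) + y) = t *: (x0 - x) + (1 - t) *: (x0 - y).
    by apply/rowP => j; rewrite !mxE; ring.
  apply: (le_lt_trans (ler_normD _ _)); rewrite !normrZ.
  rewrite ger0_norm// ger0_norm ?subr_ge0//.
  (* The strict inequality [t * |x0 - x| < t * r] used next fails for [t = 0]. *)
  have [->|t'] := eqVneq t 0; first by rewrite mul0r add0r subr0 mul1r.
  have : t * `|x0 - x| < t * r by rewrite ltr_pM2l// lt_neqAle eq_sym t'.
  have : (1 - t) * `|x0 - y| <= (1 - t) * r.
    by rewrite ler_wpM2l ?subr_ge0// ltW.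
  lra.
have dseg (t : R) : 0 <= t <= 1 -> is_derive t 1 (fun t : R => f (t *: (x - y) + y))
    ('D_(x - y) f (t *: (x - y) + y)).
  move=> t01; apply: is_derive_line; apply/diff_derivable/fd.
  by have [] := Br _ (seg _ t01).
have drv (t : R) : t \in `]0, 1[ ->
    is_derive t 1 (fun t : R => f (t *: (x - y) + y))
    ('D_(x - y) f (t *: (x - y) + y)).
  by rewrite in_itv/= => /andP[t0 t1]; apply: dseg; rewrite !ltW.
have cont : {within `[0, 1], continuous (fun t : R => f (t *: (x - y) + y))}.
  apply: derivable_within_continuous => t; rewrite in_itv/= => t01.
  by case: (dseg _ t01).
have [c] := MVT_segment ler01 drv cont.
rewrite in_itv/= scale1r scale0r subrK add0r subr0 mulr1 => c01 ->.
have [Uc Bc] := Br _ (seg _ c01).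
rewrite derive_sum_basis; last exact: fd.
rewrite -mulrA; apply: ler_norm_sum_const => [|i _]; first exact: mulr_ge0.
by rewrite normrM mulrC ler_pM// ler_mx_norm.
Unshelve. all: by end_near. Qed.

(** Segments between points of [A] may leave [U], so compactness of the product of [A] with itself
    is used instead: near the diagonal the local constant works, and away from it the quotient is
    bounded since [|x - y|] is bounded below. *)
Lemma C1_lipschitz_on (R : realType) (n : nat) (U A : set 'rV[R]_n)
    (f : 'rV[R]_n -> R) :
  open U -> C1_on U f -> A `<=` U -> compact A -> lipschitz_on A f.
Proof.
move=> oU Cf AU cA.
have fcont x : U x -> {for x, continuous f}.
  by move=> Ux; apply: differentiable_continuous; exact: Cf.1.
pose P (C : R) (u : 'rV[R]_n * 'rV[R]_n) :=
  `|f u.1 - f u.2| <= C * `|u.1 - u.2|.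
have PC : \forall C \near +oo, A `*` A `<=` P C.
  move: (compact_setX cA cA) => /compact_near_coveringP; apply.
  move=> [x y] [/= Ax Ay].
  have [->|xy] := eqVneq x y.
    have [C C0 [r r0 Cr]] := C1_locally_lipschitz oU Cf (AU _ Ay).
    have n1 : \forall u \near (y, y), ball y r u.1 /\ ball y r u.2.
      by near=> u; split; near: u; [apply: cvg_fst|apply: cvg_snd];
        exact: nbhsx_ballx.
    exists ([set u | ball y r u.1 /\ ball y r u.2], [set K | C <= K]).
      by split => //; apply: nbhs_pinfty_ge; exact: num_real.
    move=> [u K] /= [[u1 u2] CK]; rewrite /P.
    by apply: (le_trans (Cr _ _ u1 u2)); rewrite ler_wpM2r.
  have d0 : 0 < `|x - y| by rewrite normr_gt0 subr_eq0.
  pose B := 1 + `|f x - f y|; pose d := `|x - y| / 2.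
  have B0 : 0 <= B by rewrite addr_ge0.
  have d_gt0 : 0 < d by rewrite divr_gt0.
  have n1 : \forall u \near (x, y), `|f u.1 - f u.2| <= B /\ d <= `|u.1 - u.2|.
    near=> u; split; near: u.
      apply: (@cvgr_le _ _ _ _ _ `|f x - f y|); last by rewrite ltrDr.
      by apply: cvg_norm; apply: cvgB;
        apply: continuous_cvg; try exact: fcont (AU _ _);
        [exact: cvg_fst|exact: cvg_snd].
    apply: (@cvgr_ge _ _ _ _ _ `|x - y|); last first.
      by rewrite ltr_pdivrMr// ltr_pMr// ltr1n.
    by apply: cvg_norm; apply: cvgB; [exact: cvg_fst|exact: cvg_snd].
  exists ([set u | `|f u.1 - f u.2| <= B /\ d <= `|u.1 - u.2|],
    [set K | B / d <= K]).
    by split => //; apply: nbhs_pinfty_ge; exact: num_real.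
  move=> [u K] /= [[uB ud] BK]; rewrite /P.
  apply: (le_trans uB); apply: (@le_trans _ _ (B / d * d)).
    by rewrite divfK// gt_eqF.
  apply: ler_pM => //; [by rewrite divr_ge0// ltW|exact: ltW].
near (pinfty_nbhs R) => C; exists C; first by near: C; apply: nbhs_pinfty_ge; exact: num_real.
move=> x y Ax Ay; have : A `*` A `<=` P C by near: C.
by move=> /(_ (x, y)); apply.
Unshelve. all: by end_near. Qed.

(** * Stability of Lipschitz maps *)

Lemma lipschitz_on_comp (R : realType) (V W X : normedModType R) (A : set V)
    (B : set W) (f : V -> W) (g : W -> X) :
  set_fun A B f -> lipschitz_on A f -> lipschitz_on B g ->
  lipschitz_on A (g \o f).
Proof.
move=> AB [C C0 fC] [C' C'0 gC']; exists (C' * C); first exact: mulr_ge0.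
move=> x y Ax Ay; apply: (le_trans (gC' _ _ (AB _ Ax) (AB _ Ay))).
by rewrite -mulrA ler_wpM2l// fC.
Qed.

Lemma lipschitz_onB (R : realType) (V W : normedModType R) (A : set V)
    (f g : V -> W) :
  lipschitz_on A f -> lipschitz_on A g -> lipschitz_on A (f - g).
Proof.
move=> [C C0 fC] [C' C'0 gC']; exists (C + C'); first exact: addr_ge0.
move=> x y Ax Ay; rewrite !fctE.
have -> : f x - g x - (f y - g y) = (f x - f y) - (g x - g y).
  by rewrite !opprB [g y - f y]addrC addrACA [- g x + _]addrC.
by rewrite mulrDl (le_trans (ler_normB _ _))// lerD// ?fC// gC'.
Qed.

Lemma lipschitz_on_mx (R : realType) (V : normedModType R) (p q : nat)
    (A : set V) (f : V -> 'M[R]_(p, q)) :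
  (forall i j, lipschitz_on A (fun x => f x i j)) -> lipschitz_on A f.
Proof.
move=> fL; have /choice[C fC] : forall ij : 'I_p * 'I_q, exists C, 0 <= C /\
    forall x y, A x -> A y -> `|f x ij.1 ij.2 - f y ij.1 ij.2| <= C * `|x - y|.
  by move=> [i j]; have [C C0 fC] := fL i j; exists C.
have K0 : 0 <= \sum_ij C ij by apply: sumr_ge0 => ij _; have [] := fC ij.
exists (\sum_ij C ij) => // x y Ax Ay.
apply: mx_norm_le => [|i j]; first exact: mulr_ge0.
have [_ fCij] := fC (i, j); rewrite !mxE; apply: (le_trans (fCij _ _ Ax Ay)).
rewrite ler_wpM2r// (bigD1 (i, j))//= lerDl sumr_ge0// => ij _.
by have [] := fC ij.
Qed.

Lemma lipschitz_on_fst (R : realType) (V W : normedModType R) (A : set (V * W)) :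
  lipschitz_on A fst.
Proof.
exists 1 => // x y _ _; rewrite mul1r.
by rewrite [leRHS]/Num.norm/= le_max lexx.
Qed.

Lemma lipschitz_on_snd (R : realType) (V W : normedModType R) (A : set (V * W)) :
  lipschitz_on A snd.
Proof.
exists 1 => // x y _ _; rewrite mul1r.
by rewrite [leRHS]/Num.norm/= le_max lexx orbT.
Qed.

Lemma lipschitz_on_pair (R : realType) (V W X : normedModType R) (A : set V)
    (f : V -> W) (g : V -> X) :
  lipschitz_on A f -> lipschitz_on A g -> lipschitz_on A (fun x => (f x, g x)).
Proof.
move=> [C C0 fC] [C' C'0 gC']; exists (Num.max C C'); first by rewrite le_max C0.
move=> x y Ax Ay; rewrite [leLHS]/Num.norm/= ge_max; apply/andP; split.
  by apply: (le_trans (fC _ _ Ax Ay)); rewrite ler_wpM2r// le_max lexx.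
by apply: (le_trans (gC' _ _ Ax Ay)); rewrite ler_wpM2r// le_max lexx orbT.
Qed.

Lemma lipschitz_on_id (R : realType) (V : normedModType R) (A : set V) :
  lipschitz_on A id.
Proof. by exists 1 => // x y _ _; rewrite mul1r. Qed.

Lemma set_fun_iter (X : Type) (A : set X) (T : X -> X) (i : nat) :
  set_fun A A T -> set_fun A A (iter i T).
Proof. by move=> TA x Ax; elim: i => //= i; exact: TA. Qed.

Lemma lipschitz_on_iter (R : realType) (V : normedModType R) (A : set V)
    (T : V -> V) (i : nat) :
  set_fun A A T -> lipschitz_on A T -> lipschitz_on A (iter i T).
Proof.
move=> TA Tlip; elim: i => [|i IH]; first exact: lipschitz_on_id.
exact: lipschitz_on_comp (set_fun_iter i TA) IH Tlip.
Qed.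

Lemma C1_on_coord (R : realType) (n : nat) (U : set 'rV[R]_n)
    (T : 'rV[R]_n -> 'rV[R]_n) (j : 'I_n) :
  C1_on U T -> C1_on U (fun x => T x ord0 j).
Proof.
move=> [Td Tc]; split=> [x Ux|v].
  by apply: (differentiable_comp (g := fun N : 'rV[R]_n => N ord0 j));
    [exact: Td|exact: differentiable_coord].
apply: (@subspace_eq_continuous _ _ _ (fun x => 'D_v T x ord0 j)).
  move=> x /set_mem Ux; rewrite /= derive_mx ?mxE//.
  exact/diff_derivable/Td.
move=> x; have := @continuous_comp _ _ _ (fun x : subspace U => 'D_v T x)
  (fun N : 'rV[R]_n => N ord0 j) x (Tc v x).
by apply; exact: coord_continuous.
Qed.

Lemma C1_self_lipschitz_on (R : realType) (n : nat) (U A : set 'rV[R]_n)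
    (T : 'rV[R]_n -> 'rV[R]_n) :
  open U -> C1_on U T -> A `<=` U -> compact A -> lipschitz_on A T.
Proof.
move=> oU CT AU cA; apply: lipschitz_on_mx => i j; rewrite (ord1 i).
exact: C1_lipschitz_on oU (C1_on_coord j CT) AU cA.
Qed.

(** * Rank of the matrix of orbit differences *)

(** Indicators of single points generate all values on [s] by linearity. The list [s] may have
    repetitions, so orbit segments can be concatenated as they are. *)
Definition interpolates (R : realType) (V : eqType) (U : set V) (D k : nat)
    (e : 'I_D -> V -> R) :=
  forall (s : seq V) (p : V), (size s <= k)%N -> p \in s ->
    (forall q, q \in s -> U q) ->
    exists t : 'rV[R]_D, forall q, q \in s ->
      \sum_a t ord0 a * e a q = (q == p)%:R.

Lemma mxrank_colsub (F : fieldType) (p q r : nat) (f : 'I_r -> 'I_q)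
    (A : 'M[F]_(p, q)) : (\rank (colsub f A) <= \rank A)%N.
Proof.
rewrite -[in leqLHS]mxrank_tr -[in leqRHS]mxrank_tr trmx_mxsub mxrankS//.
by apply/row_subP => i; rewrite row_rowsub row_sub.
Qed.

Section rank.
Variables (R : realType) (V : eqType) (U : set V) (D m : nat).
Variable e : 'I_D -> V -> R.
Hypothesis einterp : interpolates U (2 * m) e.
Variables x z : 'I_m -> V.
Hypotheses (Ux : forall i, U (x i)) (Uz : forall i, U (z i)).
Hypothesis xz : forall i, x i != z i.

Let M : 'M[R]_(D, m) := \matrix_(a, i) (e a (x i) - e a (z i)).

(* The edges x i -- z i, i in I, form a forest of stars, each edge i having an
   end w i of its own: interpolating the indicator function of w i moves the
   i-th difference alone. *)
Lemma rank_ge_private (I : {set 'I_m}) (w : 'I_m -> V) :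
  (forall i, i \in I -> w i = x i \/ w i = z i) ->
  (forall i j, i \in I -> j \in I -> i != j -> w i != x j /\ w i != z j) ->
  (#|I| <= \rank M)%N.
Proof.
move=> wI wpriv.
have dual i : i \in I -> exists t : 'rV[R]_D, forall j, j \in I ->
    (t *m M) ord0 j = (i == j)%:R.
  move=> iI; pose s := [seq x j | j <- enum 'I_m] ++ [seq z j | j <- enum 'I_m].
  have sx j : x j \in s by rewrite mem_cat map_f ?mem_enum.
  have sz j : z j \in s by rewrite mem_cat map_f ?mem_enum ?orbT.
  have sm : (size s <= 2 * m)%N.
    by rewrite size_cat 2!size_map size_enum_ord mul2n addnn.
  have ws : w i \in s by have [->|->] := wI _ iI.
  have Us q : q \in s -> U q by rewrite mem_cat => /orP[] /mapP[j _ ->].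
  have [t tP] := einterp sm ws Us.
  have tM j : (t *m M) ord0 j = (x j == w i)%:R - (z j == w i)%:R.
    rewrite mxE -(tP _ (sx j)) -(tP _ (sz j)) -sumrB.
    by apply: eq_bigr => a _; rewrite mxE mulrBr.
  have tM0 j : j \in I -> i != j -> (t *m M) ord0 j = 0.
    move=> jI ij; have [wx wz] := wpriv _ _ iI jI ij.
    by rewrite tM ![_ == w i]eq_sym (negbTE wx) (negbTE wz) subrr.
  have [wx|wz] := wI _ iI.
    exists t => j jI; have [<-|/tM0->//] := eqVneq i j.
    by rewrite tM wx eqxx eq_sym (negbTE (xz i)) subr0.
  (* Here the private end is [z i], which enters the difference with a minus sign. *)
  exists (- t) => j jI; rewrite mulNmx mxE.
  have [<-|/tM0->//] := eqVneq i j; last by rewrite oppr0.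
  by rewrite tM wz eqxx (negbTE (xz i)) sub0r opprK.
have /choice[t tP] : forall i, exists t : 'rV[R]_D, i \in I -> forall j, j \in I ->
    (t *m M) ord0 j = (i == j)%:R.
  move=> i; have [/dual[t tP]|_] := boolP (i \in I); first by exists t.
  by exists 0.
(* The rows of [W] are dual to the columns of [M] indexed by [I], which are therefore
   independent. *)
pose W : 'M[R]_(#|I|, D) := \matrix_(a, l) t (enum_val a) ord0 l.
have WM : W *m colsub enum_val M = 1%:M.
  apply/matrixP => a b; have := tP _ (enum_valP a) _ (enum_valP b).
  rewrite (inj_eq enum_val_inj) !mxE => <-.
  by apply: eq_bigr => l _; rewrite !mxE.
rewrite -(mxrank1 R #|I|) -WM.
exact: leq_trans (mxrankM_maxr _ _) (mxrank_colsub _ _).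
Qed.

(** View the pairs [x i], [z i] as edges and take a minimal set [I] of edges touching all of [S]. By
    minimality each edge has an end in [S] touched by no other edge of [I], so the rank is at least
    [#|I|]; and [#|I|] edges have at most [2 * #|I|] ends. *)
Lemma rank_ge_cover (S : seq V) : uniq S ->
  (forall v, v \in S -> exists i, v = x i \/ v = z i) ->
  (size S <= 2 * \rank M)%N.
Proof.
move=> uS Sxz.
pose cov (I : {set 'I_m}) :=
  all (fun v => [exists i in I, (v == x i) || (v == z i)]) S.
have covT : cov (finset.setTfor 'I_m).
  apply/allP => v /Sxz[i vi]; apply/existsP; exists i; rewrite inE/=.
  by case: vi => ->; rewrite eqxx ?orbT.
have [I /minsetP[covI minI] _] := minset_exists covT.
have priv i : exists v, i \in I -> [/\ v \in S, v = x i \/ v = z i &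
    forall j, j \in I -> j != i -> v != x j /\ v != z j].
  have [iI|_] := boolP (i \in I); last by exists (x i).
  have /allPn[v vS /existsPn vI] : ~~ cov (I :\ i).
    apply/negP => covIi; have := minI _ covIi (subD1set I i).
    by move=> E; move: iI; rewrite -E !inE eqxx.
  exists v => _.
  have vj j : j \in I -> j != i -> v != x j /\ v != z j.
    move=> jI ji; have := vI j; rewrite !inE ji jI/= negb_or.
    by move=> /andP[].
  split => //; have /allP/(_ _ vS)/existsP[j /andP[jI vj']] := covI.
  have [<-|ji] := eqVneq j i; first by case/orP: vj' => /eqP; [left|right].
  by have [/negbTE h1 /negbTE h2] := vj _ jI ji; rewrite h1 h2 in vj'.
have [w wP] := choice priv.
have IM : (#|I| <= \rank M)%N.
  apply: (@rank_ge_private I w) => [i /wP[]//|i j iI jI ij].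
  by have [_ _] := wP _ iI; apply; rewrite 1?eq_sym.
apply: (@leq_trans (2 * #|I|)%N); last by rewrite leq_mul2l.
pose s := [seq x j | j <- enum I] ++ [seq z j | j <- enum I].
have -> : (2 * #|I|)%N = size s by rewrite size_cat 2!size_map -cardE mul2n addnn.
apply: uniq_leq_size => // v vS.
have /allP/(_ _ vS)/existsP[j /andP[jI vj]] := covI.
by case/orP: vj => /eqP->; rewrite mem_cat map_f ?mem_enum ?orbT.
Qed.

End rank.

(** * The polynomial probe *)

(** Differentiability is local: [g] has the same first-order expansion at [x] as [f]. *)
Lemma near_eq_differentiable (R : numFieldType) (V W : normedModType R)
    (f g : V -> W) (x : V) :
  (\near x, f x = g x) -> differentiable f x -> differentiable g x.
Proof.
move=> fg fd; have fgx : f x = g x := nbhs_singleton fg.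
have [dc df] := (diff_locallyP x f).1 fd.
have dg : g \o shift x = cst (g x) + 'd f x +o_ 0 id.
  apply/eqaddoP => e e0; move/eqaddoP : df => /(_ e e0) df.
  near=> h; rewrite !fctE /= -fgx.
  have <- : f (h + x) = g (h + x).
    by near: h; move: fg; rewrite (near_shift 0 x) subr0.
  by near: h.
apply/diff_locallyP; rewrite (diff_unique dc dg); split => //.
Unshelve. all: by end_near. Qed.

Section C1_closure.
Variables (R : realType) (n : nat) (U : set 'rV[R]_n).
Hypothesis oU : open U.
Implicit Types f g : 'rV[R]_n -> R.

(** Since [U] is open, continuity in the subspace topology is ordinary continuity at each point, to
    which neighbourhood arguments apply. *)
Lemma C1_onP f : C1_on U f <-> forall x, U x ->
  differentiable f x /\ forall v, {for x, continuous (fun x => 'D_v f x)}.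
Proof.
split=> [[fd fc] x Ux|fP].
  split=> [|v]; first exact: fd.
  by have := fc v; rewrite (continuous_open_subspace _ oU); apply; exact/mem_set.
split=> [x /fP[]//|v]; rewrite (continuous_open_subspace _ oU) => x /set_mem Ux.
by have [_] := fP x Ux; exact.
Qed.

Lemma C1_on_ext f g : (forall x, U x -> f x = g x) -> C1_on U f -> C1_on U g.
Proof.
move=> fg /C1_onP fP; apply/C1_onP => x Ux; have [fd fc] := fP x Ux.
have nfg y : U y -> \near y, f y = g y.
  move=> Uy; have := open_nbhs_nbhs (conj oU Uy).
  by apply: filterS => z; exact: fg.
split=> [|v].
  exact: near_eq_differentiable (nfg x Ux) fd.
have fgx : 'D_v f x = 'D_v g x := near_eq_derive v (nfg x Ux).
suff: (fun y => 'D_v g y) @ x --> 'D_v g x by []. rewrite -fgx.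
have nE : \near x, 'D_v f x = 'D_v g x.
  apply: filterS (open_nbhs_nbhs (conj oU Ux)) => z Uz.
  exact: near_eq_derive (nfg _ Uz).
by apply: cvg_trans (fc v); exact: near_eq_cvg nE.
Qed.

Lemma C1_on_cst (c : R) : C1_on U (cst c : 'rV[R]_n -> R).
Proof.
apply/C1_onP => x Ux; split=> [|v]; first exact: differentiable_cst.
rewrite (_ : (fun x => _) = cst 0); first exact: cst_continuous.
by apply/funext => y; exact: derive_cst.
Qed.

Lemma C1_on_proj (j : 'I_n) : C1_on U (fun x => x ord0 j).
Proof.
apply/C1_onP => x Ux; split=> [|v]; first exact: differentiable_coord.
rewrite (_ : (fun x => _) = cst (v ord0 j)); first exact: cst_continuous.
apply/funext => y /=; have did : derivable (@id 'rV[R]_n) y v by exact: derivable_id.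
have := derive_mx did.
by rewrite derive_id => /matrixP/(_ ord0 j); rewrite mxE.
Qed.

Lemma C1_onD f g : C1_on U f -> C1_on U g -> C1_on U (fun x => f x + g x).
Proof.
move=> /C1_onP fP /C1_onP gP; apply/C1_onP => x Ux.
have [[fd fc] [gd gc]] := (fP x Ux, gP x Ux).
split=> [|v]; first exact: differentiableD.
have E y : U y -> 'D_v f y + 'D_v g y = 'D_v (fun x => f x + g x) y.
  move=> Uy; rewrite -deriveD//; apply/diff_derivable.
    by have [] := fP y Uy.
  by have [] := gP y Uy.
suff: (fun y => 'D_v (fun x => f x + g x) y) @ x --> 'D_v (fun x => f x + g x) x by [].
rewrite -E//.
have nE : \near x, 'D_v f x + 'D_v g x = 'D_v (fun x => f x + g x) x.
  by apply: filterS (open_nbhs_nbhs (conj oU Ux)) => z Uz; exact: E.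
by apply: cvg_trans (cvgD (fc v) (gc v)); exact: near_eq_cvg nE.
Qed.

Lemma C1_onM f g : C1_on U f -> C1_on U g -> C1_on U (fun x => f x * g x).
Proof.
move=> /C1_onP fP /C1_onP gP; apply/C1_onP => x Ux.
have [[fd fc] [gd gc]] := (fP x Ux, gP x Ux).
split=> [|v]; first exact: differentiableM.
have E y : U y -> f y * 'D_v g y + g y * 'D_v f y = 'D_v (fun x => f x * g x) y.
  move=> Uy; rewrite -[RHS]/('D_v (f * g) y) deriveM//; apply/diff_derivable.
    by have [] := fP y Uy.
  by have [] := gP y Uy.
suff: (fun y => 'D_v (fun x => f x * g x) y) @ x --> 'D_v (fun x => f x * g x) x by [].
rewrite -E//.
have fx := differentiable_continuous fd.
have gx := differentiable_continuous gd.
have nE : \near x, f x * 'D_v g x + g x * 'D_v f x = 'D_v (fun x => f x * g x) x.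
  by apply: filterS (open_nbhs_nbhs (conj oU Ux)) => z Uz; exact: E.
by apply: cvg_trans (cvgD (cvgM fx (gc v)) (cvgM gx (fc v))); exact: near_eq_cvg nE.
Qed.

Lemma C1_on_horner (p : {poly R}) (j : 'I_n) : C1_on U (fun x => p.[x ord0 j]).
Proof.
elim/poly_ind: p => [|p c IH].
  by under eq_fun do rewrite horner0; exact: C1_on_cst.
under eq_fun do rewrite hornerMXaddC.
by apply: C1_onD; [apply: C1_onM => //; exact: C1_on_proj|exact: C1_on_cst].
Qed.

Lemma C1_on_prod (I : Type) (s : seq I) (F : I -> 'rV[R]_n -> R) :
  (forall i, C1_on U (F i)) -> C1_on U (fun x => \prod_(i <- s) F i x).
Proof.
move=> FC; elim: s => [|i s IH].
  by under eq_fun do rewrite big_nil; exact: C1_on_cst.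
by under eq_fun do rewrite big_cons; exact: C1_onM.
Qed.

(** Elements of [C1 U] vanish outside [U], so a polynomial is first cut off there. *)
Lemma C1_extension f : C1_on U f ->
  exists h : C1 U, forall x, U x -> h x = f x.
Proof.
move=> fC; have hP : patch (fun=> 0) U f \in C1_pred U.
  apply/asboolP; split; last by move=> x Ux; rewrite patchN// notin_setE.
  by apply: C1_on_ext fC => x Ux; rewrite patchT//; exact/mem_set.
by exists (MkC1 hP) => x Ux /=; rewrite patchT//; exact/mem_set.
Qed.

End C1_closure.

Lemma horner_lagrange (R : realType) (k : nat) (g : nat -> R) (q : {poly R}) (t : R) :
  injective g -> (size q <= k.+1)%N ->
  q.[t] = \sum_(a < k.+1) q.[g a] * (tnth (qpoly.lagrange k.+1 g) a : {poly R}).[t].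
Proof.
move=> ginj sq; rewrite [in LHS](qpoly.lagrange_gen _ ginj sq)// horner_sum.
by apply: eq_bigr => a _; rewrite hornerM hornerC.
Qed.

Lemma C1_sumE (R : realType) (n : nat) (U : set 'rV[R]_n) (D : nat)
    (e : 'I_D -> C1 U) (t : 'rV[R]_D) (x : 'rV[R]_n) :
  C1_val (\sum_a t ord0 a *: e a) x = \sum_a t ord0 a * e a x.
Proof.
by apply: (big_ind2 (fun (f : C1 U) (y : R) => f x = y)) => // f y g z <- <-.
Qed.

(** The basis consists of products over the coordinates of Lagrange polynomials with [k.+1] nodes,
    and spans the polynomials of degree at most [k] in each variable. Independence on [U] follows by
    evaluation at a grid of nodes inside [U]. *)
Lemma interpolating_probe (R : realType) (n : nat) (U : set 'rV[R]_n) (k : nat) :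
  open U -> U !=set0 ->
  exists (D : nat) (e : 'I_D -> C1 U),
    (forall t : 'rV[R]_D, \sum_i t ord0 i *: e i = 0 -> t = 0) /\
    interpolates U k (fun a => C1_val (e a)).
Proof.
move=> oU [c Uc].
have [r /= r0 rU] := (nbhs_ballP _ _).1 (open_nbhs_nbhs (conj oU Uc)).
(* Distinct nodes at distance at most [r / 2] from the centre, so that the whole grid lies in the
   ball contained in [U]. *)
pose g (i : 'I_n) (a : nat) := c ord0 i + r / 2 / a.+1%:R.
have ginj i : injective (g i).
  move=> a b /addrI /mulfI; rewrite gt_eqF ?divr_gt0// => /(_ isT) /invr_inj.
  by move=> /eqP; rewrite eqr_nat eqSS => /eqP.
pose I := {ffun 'I_n -> 'I_k.+1}.
pose L (i : 'I_n) (a : 'I_k.+1) : {poly R} := tnth (qpoly.lagrange k.+1 (g i)) a.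
pose E (al : I) (x : 'rV[R]_n) := \prod_i (L i (al i)).[x ord0 i].
have /choice[h hE] : forall al : I, exists h : C1 U, forall x, U x -> h x = E al x.
  move=> al; apply: C1_extension => //; apply: C1_on_prod => // i.
  exact: C1_on_horner.
pose D := #|{: I}|; pose e (a : 'I_D) := h (enum_val a).
have spanE (q : 'I_n -> {poly R}) : (forall i, (size (q i) <= k.+1)%N) ->
    forall x : 'rV[R]_n, \prod_i (q i).[x ord0 i] =
    \sum_(al : I) (\prod_i (q i).[g i (al i)]) * E al x.
  move=> sq x; under eq_bigr => i _ do rewrite (horner_lagrange _ (@ginj i) (sq i)).
  rewrite bigA_distr_bigA/=; apply: eq_bigr => al _.
  by rewrite -big_split.
exists D, e; split.
- move=> t /(congr1 (@C1_val R n U)) t0; apply/rowP => a; rewrite mxE.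
  (* At this node every basis function but the one of index [a] vanishes, which isolates the
     coefficient of [a]. *)
  pose x : 'rV[R]_n := \row_i g i (enum_val a i).
  have Ux : U x.
    apply: rU; rewrite -ball_normE/=.
    apply: (@le_lt_trans _ _ (r / 2)); last by rewrite ltr_pdivrMr// ltr_pMr// ltr1n.
    apply: mx_norm_le => [|i j]; first by rewrite divr_ge0// ltW.
    rewrite (ord1 i) !mxE /g opprD addrA subrr sub0r normrN ger0_norm; last first.
      by rewrite !divr_ge0// ltW.
    by rewrite ler_pdivrMr// ler_peMr ?ler1n// divr_ge0// ltW.
  have := congr1 (fun f => f x) t0; rewrite C1_sumE (bigD1 a)//= big1 => [|b ba].
    rewrite addr0 /e hE// /E big1 ?mulr1// => i _.
    by rewrite mxE qpoly.lagrange_sample ?eqxx.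
  have [i abi] : exists i, (enum_val b : I) i != (enum_val a : I) i.
    apply/existsP; apply: contraR ba; rewrite negb_exists => /forallP abE.
    by apply/eqP/enum_val_inj/ffunP => i; apply/eqP; rewrite -[_ == _]negbK abE.
  rewrite /e hE// /E (bigD1 i)//= mxE qpoly.lagrange_sample// (negbTE abi).
  by rewrite mul0r mulr0.
- move=> s p sk ps sU.
  (* Each point [r] of [s] other than [p] is assigned one coordinate where it differs from [p]. The
     polynomial of that coordinate receives a linear factor equal to 1 at [p] and 0 at [r]; [p]
     itself contributes no factor. *)
  pose ch (r : 'rV[R]_n) := [pick i | r ord0 i != p ord0 i].
  pose q (i : 'I_n) : {poly R} := \prod_(r <- s | ch r == Some i)
    ((p ord0 i - r ord0 i)^-1 *: ('X - (r ord0 i)%:P)).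
  have sq i : (size (q i) <= k.+1)%N.
    apply: leq_trans (_ : (size s).+1 <= k.+1)%N => //; rewrite /q.
    elim: (s) => [|u s' IH]; first by rewrite big_nil size_poly1.
    rewrite big_cons; case: ifP => _; last exact: leqW.
    apply: (leq_trans (size_polyMleq _ _)).
    have predle i1 i2 i3 : (i1 <= 2 -> i2 <= i3 -> (i1 + i2).-1 <= i3.+1)%N by lia.
    apply: predle IH => /=.
    by rewrite (leq_trans (size_scale_leq _ _))// size_XsubC.
  have qE x : \prod_i (q i).[x ord0 i] = \prod_i \prod_(r <- s | ch r == Some i)
      ((p ord0 i - r ord0 i)^-1 * (x ord0 i - r ord0 i)).
    apply: eq_bigr => i _; rewrite horner_prod; apply: eq_bigr => u _.
    by rewrite hornerZ hornerXsubC.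
  exists (\row_a \prod_i (q i).[g i ((enum_val a : I) i)]) => x xs.
  have -> : \sum_a (\row_a \prod_i (q i).[g i ((enum_val a : I) i)]) ord0 a * e a x =
      \prod_i (q i).[x ord0 i].
    rewrite (spanE q sq) (big_enum_val (A := {: I})) /=.
    by apply: eq_bigr => a _; rewrite mxE /e hE//; exact: sU.
  rewrite qE; have [->|xp] := eqVneq x p.
    rewrite big1// => i _; rewrite big1// => u.
    rewrite /ch; case: pickP => // j uj /eqP[<-]; rewrite mulVf//.
    by rewrite subr_eq0 eq_sym.
  have [i xi] : exists i, ch x = Some i.
    rewrite /ch; case: pickP => [i _|xpE]; first by exists i.
    move/eqP: xp; case; apply/rowP => i; apply/eqP.
    by have /negbT := xpE i; rewrite negbK.
  rewrite (bigD1 i)//= (big_rem x)//= xi eqxx subrr mulr0 !mul0r.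
  by [].
Qed.

(** * Injectivity of the delay map for almost every parameter *)

Lemma lipschitz_on_sub (R : realType) (V W : normedModType R) (A B : set V)
    (f : V -> W) : A `<=` B -> lipschitz_on B f -> lipschitz_on A f.
Proof. by move=> AB [C C0 fC]; exists C => // x y /AB Bx /AB By; exact: fC. Qed.

(** Injectivity cancels iterates, so a repetition at times [i < j] gives the return time [j - i]; a
    trajectory stopped at its least return time has no repetition. *)
Lemma uniq_traject_or_periodic (X : eqType) (A : set X) (T : X -> X) (m : nat) (x : X) :
  set_fun A A T -> (forall u v, A u -> A v -> T u = T v -> u = v) -> A x ->
  uniq (traject T x m) \/
  exists p, [/\ (0 < p <= m)%N, iter p T x = x & uniq (traject T x p)].
Proof.
move=> TA Tinj Ax.
have iterI k u v : A u -> A v -> iter k T u = iter k T v -> u = v.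
  elim: k => //= k IH Au Av Tuv; apply: IH => //.
  by apply: Tinj Tuv; exact: set_fun_iter.
have uniq_traj k : (forall p, (0 < p < k)%N -> iter p T x != x) -> uniq (traject T x k).
  move=> noper; apply/(uniqP x) => i j; rewrite !inE !size_traject => ik jk.
  rewrite !nth_traject//.
  wlog ij : i j ik jk / (i <= j)%N.
    move=> W E; have [ij|/ltnW ij] := leqP i j; first exact: W ij E.
    exact/esym/(W j i jk ik ij)/esym.
  rewrite -(subnKC ij) iterD => /iterI.
  move=> /(_ Ax (set_fun_iter _ TA Ax)) E.
  have [j0|j0] := posnP (j - i)%N; first by rewrite j0 addn0.
  by have := noper (j - i)%N; rewrite -E eqxx => /(_ _)/implyP; lia.
have [[p [/andP[p0 pm] Tp]]|noper] :=
    pselect (exists p, (0 < p < m)%N /\ iter p T x = x); last first.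
  left; apply: uniq_traj => p pm; apply/eqP => Tp; apply: noper; by exists p.
right; pose per q := (0 < q)%N && (iter q T x == x).
have exper : exists q, per q by exists p; rewrite /per p0 Tp eqxx.
case: (ex_minnP exper) => q /andP[q0 /eqP Tq] qmin; exists q; split => //.
  by rewrite q0 (leq_trans (qmin p _))// ?/per ?p0 ?Tp ?eqxx// ltnW.
apply: uniq_traj => l /andP[l0 lq]; apply/negP => Tl.
by have := qmin l; rewrite /per l0 Tl => /(_ isT); rewrite leqNgt lq.
Qed.

Section injectivity.
Variables (R : realType) (n : nat) (U A : set 'rV[R]_n) (T : 'rV[R]_n -> 'rV[R]_n).
Variables (m D : nat) (e : 'I_D -> 'rV[R]_n -> R) (y : 'rV[R]_n -> R).
Hypotheses (AU : A `<=` U) (TA : set_fun A A T).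
Hypothesis Tinj : forall u v, A u -> A v -> T u = T v -> u = v.
Hypotheses (Tlip : lipschitz_on A T) (ylip : lipschitz_on A y).
Hypothesis elip : forall a, lipschitz_on A (e a).
Hypothesis einterp : interpolates U (2 * m) e.

Let V := 'rV[R]_n.

(** [t *m M q + b q] is the difference of the delay vectors of [q.1] and [q.2] for the observable
    [y] perturbed by the probe with coefficients [t]. *)
Let M (q : V * V) : 'M[R]_(D, m) :=
  \matrix_(a, i) (e a (iter i T q.1) - e a (iter i T q.2)).
Let b (q : V * V) : 'rV[R]_m := \row_i (y (iter i T q.1) - y (iter i T q.2)).
Let zeros (P : set (V * V)) : set 'rV[R]_D :=
  [set t | exists2 q, P q & t *m M q + b q = 0].

Let iterA i x : A x -> A (iter i T x).
Proof. exact: set_fun_iter. Qed.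

Let iter_inj k u v : A u -> A v -> iter k T u = iter k T v -> u = v.
Proof.
elim: k => //= k IH Au Av Tuv; apply: IH => //.
by apply: Tinj Tuv; exact: iterA.
Qed.

Let lip_orbit_diff (f : V -> R) i : lipschitz_on A f ->
  lipschitz_on (A `*` A) (fun q => f (iter i T q.1) - f (iter i T q.2)).
Proof.
move=> flip; have fT := lipschitz_on_comp (set_fun_iter i TA)
  (lipschitz_on_iter i TA Tlip) flip.
apply: (@lipschitz_onB _ _ _ _ (fun q : V * V => f (iter i T q.1))
  (fun q : V * V => f (iter i T q.2))).
- apply: (@lipschitz_on_comp _ _ _ _ _ A fst) fT; last exact: lipschitz_on_fst.
  by move=> q [].
- apply: (@lipschitz_on_comp _ _ _ _ _ A snd) fT; last exact: lipschitz_on_snd.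
  by move=> q [].
Qed.

Lemma zeros_null (P : set (V * V)) (s : R) :
  P `<=` A `*` A -> coverable P s -> (forall q, P q -> s < (\rank (M q))%:R) ->
  lebesgue_null (zeros P).
Proof.
move=> PA Ps rkP; apply: zero_set_null Ps rkP.
  apply: (lipschitz_on_sub PA); apply: lipschitz_on_mx => a i.
  rewrite [X in lipschitz_on _ X](_ : _ =
    fun q => e a (iter i T q.1) - e a (iter i T q.2)); first exact: lip_orbit_diff.
  by apply/funext => q; rewrite mxE.
apply: (lipschitz_on_sub PA); apply: lipschitz_on_mx => a i.
rewrite [X in lipschitz_on _ X](_ : _ =
  fun q => y (iter i T q.1) - y (iter i T q.2)); first exact: lip_orbit_diff.
by apply/funext => q; rewrite mxE.
Qed.

(** Injectivity of the iterates keeps the two ends of each edge distinct, as [rank_ge_cover]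
    requires. *)
Let rank_touched (x z : V) (S : seq V) k : size S = k -> A x -> A z -> x <> z -> uniq S ->
  (forall v, v \in S -> exists2 i, (i < m)%N & v = iter i T x \/ v = iter i T z) ->
  k%:R / 2 <= (\rank (M (x, z)))%:R :> R.
Proof.
move=> <- Ax Az xz uS Sxz.
rewrite ler_pdivrMr// -natrM ler_nat mulnC.
apply: (rank_ge_cover einterp (x := fun i : 'I_m => iter i T x)
  (z := fun i : 'I_m => iter i T z)) uS _.
- by move=> i; apply: AU; exact: iterA.
- by move=> i; apply: AU; exact: iterA.
- by move=> i; apply/eqP => /iter_inj; auto.
- by move=> v /Sxz[i im vi]; exists (Ordinal im).
Qed.

Variables (d : R) (B : R).
Hypotheses (AB : forall x, A x -> `|x| <= B) (Adim : has_boxdim A d).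
Hypothesis dm : 2 * d < m%:R.
Hypothesis Aper : forall p, (1 <= p <= m)%N ->
  exists2 dp : R, has_boxdim (periodic_points T A p) dp & dp < p%:R / 2.

Let A_coverable : exists2 s, s < m%:R / 2 & coverable A s.
Proof.
(* The midpoint of [d] and [m / 2] leaves room on both sides. *)
exists ((d + m%:R / 2) / 2); first by have := dm; lra.
by apply: has_boxdim_coverable AB Adim _; have := dm; lra.
Qed.

Let per_coverable p : (1 <= p <= m)%N ->
  exists2 s, s < p%:R / 2 & coverable (periodic_points T A p) s.
Proof.
move=> /Aper[dp dimp dpp]; exists ((dp + p%:R / 2) / 2); first lra.
apply: (has_boxdim_coverable (M := B)) dimp _; last lra.
by move=> x [Ax _]; exact: AB.
Qed.

(** For fixed [j], a pair on one orbit is a Lipschitz function of its first point, so such pairs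
    have the covering exponent of a single copy of the set. *)
Let graph (j : nat) (x : V) := (x, iter j T x).

Let lip_graph j (C : set V) : C `<=` A -> lipschitz_on C (graph j).
Proof.
move=> CA; apply: (lipschitz_on_sub CA).
by apply: lipschitz_on_pair; [exact: lipschitz_on_id|exact: lipschitz_on_iter].
Qed.

(** The [m] distinct points of the segment from [x] give rank at least [m / 2], above the covering
    exponent of [A]. *)
Let null_free_orbit j : lebesgue_null (zeros (graph j @`
  [set x | [/\ A x, x <> iter j T x & uniq (traject T x m)]])).
Proof.
have [s sm As] := A_coverable; apply: (@zeros_null _ s).
- by move=> _ [x [Ax _ _] <-]; split => //=; exact: iterA.
- apply: coverable_image; first by apply: lip_graph => x [].
  by apply: coverable_sub As => x [].
- move=> _ [x [Ax xj ux] <-]; apply: (lt_le_trans sm).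
  apply: (rank_touched (size_traject T x m)) => //; first exact: iterA.
  by move=> v /trajectP[i im ->]; exists i => //; left.
Qed.

(** Only [p] distinct points are at hand, so the rank is known to be at least [p / 2]; the dimension
    bound on the periodic points matches it. *)
Let null_periodic_orbit j p : (1 <= p <= m)%N -> lebesgue_null (zeros (graph j @`
  [set x | [/\ periodic_points T A p x, x <> iter j T x & uniq (traject T x p)]])).
Proof.
move=> pm; have [s sm As] := per_coverable pm; apply: (@zeros_null _ s).
- by move=> _ [x [[Ax _] _ _] <-]; split => //=; exact: iterA.
- apply: coverable_image; first by apply: lip_graph => x [[]].
  by apply: coverable_sub As => x [].
- move=> _ [x [[Ax _] xj ux] <-]; apply: (lt_le_trans sm).
  apply: (rank_touched (size_traject T x p)) => //; first exact: iterA.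
  move=> v /trajectP[i ip ->]; exists i; last by left.
  by case/andP: pm => _; exact: leq_trans.
Qed.

Let disj (x z : V) := forall i k, (i < m)%N -> (k < m)%N -> iter i T x <> iter k T z.

(** The covering exponent doubles, to a value still below [m]. Each [iter i T x] belongs to the
    [i]-th edge alone, so the rank is at least [m]. *)
Let null_free_pair : lebesgue_null (zeros
  [set q | [/\ A q.1, A q.2, q.1 <> q.2, uniq (traject T q.1 m) & disj q.1 q.2]]).
Proof.
have [s sm As] := A_coverable; apply: (@zeros_null _ (s + s)).
- by move=> q [].
- by apply: coverable_sub (coverableX As As) => q [].
- move=> [x z] [/= Ax Az xz ux dxz]; apply: (@lt_le_trans _ _ m%:R); first lra.
  rewrite ler_nat -[leqLHS]card_ord -cardsT.
  apply: (rank_ge_private einterp (x := fun i : 'I_m => iter i T x)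
    (z := fun i : 'I_m => iter i T z) _ _ _ (w := fun i : 'I_m => iter i T x)).
  + by move=> i; apply: AU; exact: iterA.
  + by move=> i; apply: AU; exact: iterA.
  + by move=> i; apply/eqP => /iter_inj; auto.
  + by move=> i _; left.
  + move=> i j _ _ ij; split; apply/eqP; last exact: dxz.
    move=> xij; move/eqP: ij; apply; apply/val_inj/eqP.
    have sz k : (k < m)%N -> (k < size (traject T x m))%N by rewrite size_traject.
    rewrite -(nth_uniq x (sz _ (ltn_ord i)) (sz _ (ltn_ord j)) ux).
    by rewrite !nth_traject//; exact/eqP.
Qed.

(** The two disjoint cycles have [p + p'] points, so the rank is at least [(p + p') / 2], above the
    sum of the two covering exponents. *)
Let null_periodic_pair p p' : (1 <= p <= m)%N -> (1 <= p' <= m)%N ->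
  lebesgue_null (zeros [set q | [/\ periodic_points T A p q.1,
    periodic_points T A p' q.2, q.1 <> q.2,
    uniq (traject T q.1 p) /\ uniq (traject T q.2 p') & disj q.1 q.2]]).
Proof.
move=> pm pm'; have [s sp As] := per_coverable pm.
have [s' sp' As'] := per_coverable pm'; apply: (@zeros_null _ (s + s')).
- by move=> q [[? _] [? _]].
- by apply: coverable_sub (coverableX As As') => q [].
- move=> [x z] [/= [Ax _] [Az _] xz [ux uz] dxz].
  have {}pm : (p <= m)%N by case/andP: pm.
  have {}pm' : (p' <= m)%N by case/andP: pm'.
  apply: (@lt_le_trans _ _ ((p + p')%:R / 2)); first by rewrite natrD; lra.
  apply: (@rank_touched _ _ (traject T x p ++ traject T z p')) => //.
  - by rewrite size_cat !size_traject.
  - rewrite cat_uniq ux uz andbT; apply/hasPn => v /trajectP[k kp' ->].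
    apply/trajectP => -[i ip]; apply/nesym/dxz; exact: leq_trans pm || exact: leq_trans pm'.
  - move=> v; rewrite mem_cat => /orP[] /trajectP[i ip ->]; exists i.
  + exact: leq_trans pm.
  + by left.
  + exact: leq_trans pm'.
  + by right.
Qed.

Lemma delay_injective_null : lebesgue_null [set t : 'rV[R]_D |
  ~ forall x z, A x -> A z ->
    delay_map m (fun u => y u + \sum_a t ord0 a * e a u) T x =
    delay_map m (fun u => y u + \sum_a t ord0 a * e a u) T z -> x = z].
Proof.
(* This lets the unions below run over all naturals, with the range of the periods as a side
   condition. *)
have null0 (Q : Prop) (N : set 'rV[R]_D) :
    (Q -> lebesgue_null N) -> lebesgue_null [set t | Q /\ N t].
  move=> QN; have [/QN|nQ] := pselect Q.
    by apply: lebesgue_null_sub => t [].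
  apply: lebesgue_null_cubes => c c0; exists 0, [::]; split => //=.
    by rewrite mul0r ltW.
  by move=> t [].
(* In order: pairs on one orbit, without repetition or periodic; then pairs with disjoint segments,
   the first without repetition or both periodic. *)
pose N : set 'rV[R]_D := (\bigcup_j zeros (graph j @`
    [set x | [/\ A x, x <> iter j T x & uniq (traject T x m)]])) `|`
  (\bigcup_(jp : nat * nat) [set t | (1 <= jp.2 <= m)%N /\ zeros (graph jp.1 @`
    [set x | [/\ periodic_points T A jp.2 x, x <> iter jp.1 T x &
      uniq (traject T x jp.2)]]) t]) `|`
  (zeros [set q | [/\ A q.1, A q.2, q.1 <> q.2, uniq (traject T q.1 m) &
    disj q.1 q.2]]) `|`
  (\bigcup_(pp : nat * nat) [set t | ((1 <= pp.1 <= m)%N /\ (1 <= pp.2 <= m)%N) /\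
    zeros [set q | [/\ periodic_points T A pp.1 q.1,
      periodic_points T A pp.2 q.2, q.1 <> q.2,
      uniq (traject T q.1 pp.1) /\ uniq (traject T q.2 pp.2) & disj q.1 q.2]] t]).
apply: (@lebesgue_null_sub _ _ _ N); last first.
  apply: lebesgue_nullU; last first.
    apply: lebesgue_null_bigcup => pp; apply: null0 => -[].
    exact: null_periodic_pair.
  apply: lebesgue_nullU => //; apply: lebesgue_nullU.
    exact: lebesgue_null_bigcup.
  apply: lebesgue_null_bigcup => jp; apply: null0; exact: null_periodic_orbit.
move=> t /existsNP[x /existsNP[z /not_implyP[Ax /not_implyP[Az /not_implyP[txz xz]]]]].
pose bad x z := [/\ A x, A z, x <> z & t *m M (x, z) + b (x, z) = 0].
have bad_swap u v : bad u v -> bad v u.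
  move=> [Au Av uv tuv]; split => //; first exact/nesym.
  have -> : t *m M (v, u) + b (v, u) = - (t *m M (u, v) + b (u, v)).
    have -> : M (v, u) = - M (u, v) by apply/matrixP => a i; rewrite !mxE opprB.
    have -> : b (v, u) = - b (u, v) by apply/matrixP => a i; rewrite !mxE opprB.
    by rewrite mulmxN opprD.
  by rewrite tuv oppr0.
have {txz xz Ax Az}: bad x z.
  split => //; apply/rowP => i; move/rowP: txz => /(_ i); rewrite !mxE => txz.
  rewrite (eq_bigr (fun a => t ord0 a * e a (iter i T x) -
    t ord0 a * e a (iter i T z))) => [|a _]; last by rewrite mxE mulrBr.
  by rewrite sumrB /=; lra.
move=> xzbad.
have same_orbit u j : bad u (iter j T u) -> N t.
  move=> [Au Auj uj tu]; left; left.
  have [uu|[p [pm Tp uu]]] := uniq_traject_or_periodic m TA Tinj Au.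
    by left; exists j => //; exists (graph j u) => //; exists u.
  by right; exists (j, p) => //; split => //; exists (graph j u) => //; exists u.
have [[i [k [im [km ik]]]]|dxz] := pselect (exists i k, (i < m)%N /\ (k < m)%N /\
    iter i T x = iter k T z).
  (* By symmetry [i <= k]; cancelling [i] iterates then puts [x] on the forward orbit of [z]. *)
  wlog le_ik : x z i k im km ik xzbad / (i <= k)%N.
    move=> W; case/orP: (leq_total i k) => ik'; first exact: (W x z i k).
    by apply: (W z x k i) => //; exact: bad_swap.
  have [Ax Az _ _] := xzbad; apply: (same_orbit z (k - i)%N).
  move: ik; rewrite -{1}(subnKC le_ik) iterD => /iter_inj <- //; last exact: iterA.
  exact: bad_swap.
have {}dxz : disj x z by move=> i k im km ik; apply: dxz; exists i, k.
have dzx : disj z x by move=> i k im km /esym; exact: dxz.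
have [Ax Az xz tx] := xzbad; have [_ _ zx tz] := bad_swap _ _ xzbad.
have [ux|[p [pm Tp ux]]] := uniq_traject_or_periodic m TA Tinj Ax.
  by left; right; exists (x, z).
(* If only the segment from [z] is known to be free of repetition, the swapped pair is used. *)
have [uz|[p' [pm' Tp' uz]]] := uniq_traject_or_periodic m TA Tinj Az.
  by left; right; exists (z, x).
by right; exists (p, p') => //; split => //; exists (x, z).
Qed.

End injectivity.

(** * Borel measurability of injectivity *)

Lemma C1_nbhs_uniform (R : realType) (n : nat) (U A : set 'rV[R]_n)
    (y0 : C1 U) (d : R) :
  A `<=` U -> compact A -> 0 < d ->
  nbhs y0 [set y : C1 U | forall x, A x -> `|y0 x - y x| < d].
Proof.
move=> AU cA d0.
have jcont : {for y0, continuous (@C1_jet R n U)} by exact: initial_continuous.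
pose N := [set g : {family compactly_in U, 'rV[R]_n -> R} |
  forall x, A x -> `|y0 x - g x| < d].
have nN : nbhs ((C1_jet y0).1) N.
  apply: (fam_nbhs (E := [set xy : R * R | `|xy.1 - xy.2| < d])) => //.
  by rewrite -entourage_from_ballE; exists d.
apply: (jcont (fst @^-1` N)).
by exists (N, setT); [split => //; exact: filterT|move=> ? []].
Qed.

Lemma continuous_mx (R : realType) (X : topologicalType) (p q : nat)
    (f : X -> 'M[R]_(p, q)) (x : X) :
  (forall i j, {for x, continuous (fun u => f u i j)}) -> {for x, continuous f}.
Proof.
move=> fc; apply/cvgrPdist_le => e e0; near=> u.
apply: mx_norm_le => [|i j]; first exact: ltW.
have : forall ij : 'I_p * 'I_q, `|f x ij.1 ij.2 - f u ij.1 ij.2| <= e.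
  near: u; apply: filter_forall => -[i j].
  by have /cvgrPdist_le := fc i j; apply.
by move=> /(_ (i, j)); rewrite !mxE.
Unshelve. all: by end_near. Qed.

Section delay_topology.
Variables (R : realType) (n : nat) (U A : set 'rV[R]_n) (T : 'rV[R]_n -> 'rV[R]_n).
Variable m : nat.
Hypotheses (AU : A `<=` U) (cA : compact A).
Hypotheses (TU : set_fun U U T) (TA : set_fun A A T).
Hypothesis Tcont : forall x, U x -> {for x, continuous T}.

Lemma iter_continuous i x : U x -> {for x, continuous (iter i T)}.
Proof.
move=> Ux; elim: i => [|i IH]; first exact: cvg_id.
by apply: continuous_comp => //; apply: Tcont; exact: (set_fun_iter i TU Ux).
Qed.

Lemma delay_coord_continuous (y : 'rV[R]_n -> R) i x :
  (forall x, U x -> {for x, continuous y}) -> U x ->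
  {for x, continuous (fun u => y (iter i T u))}.
Proof.
move=> yc Ux; apply: (@continuous_comp _ _ _ (iter i T) y).
  exact: iter_continuous.
by apply: yc; exact: (set_fun_iter i TU Ux).
Qed.

Lemma delay_map_continuous (y : 'rV[R]_n -> R) x :
  (forall x, U x -> {for x, continuous y}) -> U x ->
  {for x, continuous (delay_map m y T)}.
Proof.
move=> yc Ux; apply: continuous_mx => i j.
rewrite (_ : (fun u => _) = fun u => y (iter j T u)).
  exact: delay_coord_continuous.
by apply/funext => u; rewrite mxE.
Qed.

Lemma C1_continuous (y : C1 U) x : U x -> {for x, continuous y}.
Proof.
move=> Ux; apply: differentiable_continuous.
by have /asboolP[[yd _] _] := C1_valP y; exact: yd.
Qed.

(** By compactness, the pairs of points of [A] at distance at least [c] have some delay coordinate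
    differing by more than a uniform [d > 0]. Changing [y] by less than [d / 2] on [A] cannot cancel
    this. *)
Lemma delay_separating_open (c : R) : open [set y : C1 U |
  forall x z, A x -> A z -> c <= `|x - z| -> delay_map m y T x <> delay_map m y T z].
Proof.
rewrite openE => y0 sep /=.
(* The predicate is vacuous for close points, so compactness can be applied to the full product of
   [A] with itself. *)
pose P (d : R) (u : 'rV[R]_n * 'rV[R]_n) := c <= `|u.1 - u.2| ->
  exists i : 'I_m, d < `|y0 (iter i T u.1) - y0 (iter i T u.2)|.
have Pd : \forall d \near 0^'+, A `*` A `<=` P d.
  move: (compact_setX cA cA) => /compact_near_coveringP; apply.
  move=> [x z] [/= Ax Az]; have [cxz|xzc] := leP c `|x - z|; last first.
    have ltc : \forall u \near (x, z), `|u.1 - u.2| < c.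
      near=> u; near: u.
      apply: (@cvgr_lt _ _ _ _ _ `|x - z|) => //.
      by apply: cvg_norm; apply: cvgB; [exact: cvg_fst|exact: cvg_snd].
    exists ([set u | `|u.1 - u.2| < c], setT) => /=.
      by split => //; exact: filterT.
    by move=> [u d] /= [uc _]; rewrite /P leNgt uc.
  have [i xzi] : exists i : 'I_m, y0 (iter i T x) != y0 (iter i T z).
    apply/existsP; apply: contra_notT (sep _ _ Ax Az cxz).
    rewrite negb_exists => /forallP E; apply/rowP => i; rewrite !mxE.
    by apply/eqP; rewrite -[_ == _]negbK E.
  pose f (u : 'rV[R]_n * 'rV[R]_n) := `|y0 (iter i T u.1) - y0 (iter i T u.2)|.
  have f0 : 0 < f (x, z) by rewrite normr_gt0 subr_eq0.
  have gef : \forall u \near (x, z), f (x, z) / 2 <= f u.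
    near=> u; near: u.
    apply: (@cvgr_ge _ _ _ _ _ (f (x, z))); last first.
      by rewrite ltr_pdivrMr// ltr_pMr// ltr1n.
    have yc := @C1_continuous y0.
    have cont u : A u -> {for u, continuous (fun v => y0 (iter i T v))}.
      by move=> /AU Uu; exact: delay_coord_continuous.
    have cvgx : y0 (iter i T u.1) @[u --> (x, z)] --> y0 (iter i T x).
      by apply: (cvg_comp fst (fun v => y0 (iter i T v)) _ (cont _ Ax)); exact: cvg_fst.
    have cvgz : y0 (iter i T u.2) @[u --> (x, z)] --> y0 (iter i T z).
      by apply: (cvg_comp snd (fun v => y0 (iter i T v)) _ (cont _ Az)); exact: cvg_snd.
    exact: cvg_norm (cvgB cvgx cvgz).
  exists ([set u | f (x, z) / 2 <= f u], [set d | d < f (x, z) / 2]) => /=.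
    by split => //; apply: nbhs_right_lt; rewrite divr_gt0.
  move=> [u d] /= [fu df]; rewrite /P => _; exists i; exact: lt_le_trans fu.
near (0:R)^'+ => d.
have d0 : 0 < d by near: d; exact: nbhs_right_gt.
have Pdd : A `*` A `<=` P d by near: d.
(* As [A] is stable under [T], closeness on [A] controls every delay coordinate, and the two errors
   add up to at most [d]. *)
apply: filterS (C1_nbhs_uniform y0 AU cA (divr_gt0 d0 (ltr0n _ 2))) => y yy0.
move=> x z Ax Az cxz xz; have [i] := Pdd (x, z) (conj Ax Az) cxz.
have := congr1 (fun v : 'rV[R]_m => v ord0 i) xz; rewrite !mxE => yxz.
apply/negP; rewrite -leNgt /=.
have yx := yy0 _ (set_fun_iter i TA Ax); have yz := yy0 _ (set_fun_iter i TA Az).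
rewrite (_ : y0 _ - y0 _ = (y0 (iter i T x) - y (iter i T x)) -
  (y0 (iter i T z) - y (iter i T z))); last by rewrite yxz; ring.
by apply: (le_trans (ler_normB _ _)); rewrite [leRHS]splitr lerD// ltW.
Unshelve. all: by end_near. Qed.

(** Injectivity means separation at every scale [1 / k.+1]: a countable intersection of open sets,
    rewritten with complements and a union. *)
Lemma delay_injective_borel : <<s open >> [set y : C1 U |
  forall x z, A x -> A z -> delay_map m y T x = delay_map m y T z -> x = z].
Proof.
have [s0 sC sU] := @smallest_sigma_algebra _ [set: C1 U] open.
pose O (k : nat) := [set y : C1 U | forall x z, A x -> A z ->
  k.+1%:R^-1 <= `|x - z| -> delay_map m y T x <> delay_map m y T z].
rewrite (_ : [set _ | _] = setT `\` \bigcup_k (setT `\` O k)).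
  apply: (sC); apply: sU => k; apply: (sC).
  by apply: sub_sigma_algebra; exact: (@delay_separating_open k.+1%:R^-1).
apply/seteqP; split=> y /=.
  move=> inj; split => // -[k _ [_]]; apply => x z Ax Az kxz /(inj _ _ Ax Az) xz.
  by move: kxz; rewrite xz subrr normr0 leNgt invr_gt0 ltr0n.
move=> [_ yO] x z Ax Az xz; apply/eqP/negPn/negP => nxz; apply: yO.
have xz0 : 0 < `|x - z| by rewrite normr_gt0 subr_eq0.
exists (Num.truncn `|x - z|^-1) => //; split => // /(_ x z Ax Az); apply => //.
by rewrite -[leRHS]invrK lef_pV2 ?posrE ?invr_gt0// ltW// truncnS_gt.
Qed.

End delay_topology.

(** * Supports and conjugacy *)

Lemma open_setI_preimage (X Y : topologicalType) (U : set X) (f : X -> Y)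
    (B : set Y) :
  open U -> (forall x, U x -> {for x, continuous f}) -> open B ->
  open (U `&` f @^-1` B).
Proof.
move=> oU fc oB; rewrite openE => z [Uz Bz].
apply: filterI; first exact: open_nbhs_nbhs.
by apply: (fc _ Uz); exact: open_nbhs_nbhs.
Qed.

Section support.
Variables (R : realType) (n : nat) (mu : probability (borelType R n) R).
Let V := 'rV[R]_n.

Lemma open_borel (O : set V) : open O -> measurable (O : set (borelType R n)).
Proof. exact: sub_sigma_algebra. Qed.

Lemma supp_closed : closed (supp mu).
Proof. by apply: closed_bigI => C []. Qed.

Lemma notin_supp (x : V) :
  ~ supp mu x <-> exists O : set V, [/\ open O, O x & mu O = 0%E].
Proof.
split=> [|[Z [oZ Zx Z0]] sx].
  move=> /existsNP[C /not_implyP[[cC C0] Cx]].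
  by exists (~` C); split => //; exact: closed_openC.
have := sx (~` Z); rewrite /= setCK; apply => //; split => //.
exact: open_closedC.
Qed.

(** A countable base of the topology, for the proof that the complement of the support is null. *)
Lemma rational_ball (x : V) (O : set V) : open O -> O x ->
  exists (c : 'rV[rat]_n) (r : rat), let b := ball (map_mx ratr c : V) (ratr r : R) in
    b x /\ b `<=` O.
Proof.
move=> oO Ox; have [e /= e0 eO] := (nbhs_ballP _ _).1 (open_nbhs_nbhs (conj oO Ox)).
have [r] := rat_in_itvoo (divr_gt0 e0 (ltr0n _ 2)).
rewrite in_itv/= => /andP[r0 re].
(* Centre coordinates within [r] of those of [x] put [x] in the ball, and [2 * r < e] keeps the ball
   inside [O]. *)
have /choice[c xc] : forall i : 'I_n, exists c : rat,
    ratr c \in `]x ord0 i, (x ord0 i + ratr r)[%R.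
  by move=> i; apply: rat_in_itvoo; rewrite ltrDl.
exists (\row_i c i), r => /=.
have xb : ball (map_mx ratr (\row_i c i) : V) (ratr r : R) x.
  split => // i j; rewrite (ord1 i) /ball/= !mxE.
  have := xc j; rewrite in_itv/= => /andP[h1 h2].
  by rewrite gtr0_norm ?subr_gt0// ltrBlDl.
split => // z; move: xb; rewrite -ball_normE /= => xb zb.
apply: eO; rewrite -ball_normE/=; set c' := map_mx _ _ in xb zb.
have -> : x - z = (c' - z) - (c' - x) by rewrite opprB [RHS]addrC addrA subrK.
by apply: (le_lt_trans (ler_normB _ _)); lra.
Qed.

(** Every point outside the support has a null open neighbourhood, hence lies in one of countably
    many null rational balls. *)
Lemma measure_setC_supp : mu (~` supp mu) = 0%E.
Proof.
pose b (q : 'rV[rat]_n * rat) : set V := ball (map_mx ratr q.1 : V) (ratr q.2 : R).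
pose F (k : nat) : set (borelType R n) :=
  if unpickle k is Some q then if mu (b q) == 0%E then b q else set0 else set0.
have mb q : measurable (b q : set (borelType R n)).
  by apply: open_borel; exact: ball_open.
have mF k : measurable (F k) /\ mu (F k) = 0%E.
  rewrite /F; case: unpickle => [q|]; last by rewrite measure0.
  by case: ifPn => [/eqP q0|_]; last rewrite measure0.
apply: measure_negligible.
  by apply: open_borel; exact: closed_openC supp_closed.
apply: (negligibleS (A := \bigcup_k F k)).
  move=> x /notin_supp[Z [oZ Zx Z0]].
  have [c [r /= [bx bO]]] := rational_ball oZ Zx.
  exists (pickle (c, r)) => //; rewrite /F pickleK ifT//.
  apply/eqP; apply: (subset_measure0 (mb (c, r)) (open_borel oZ)) Z0.
  exact: bO.
apply: negligible_bigcup => k; have [mk Fk] := mF k.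
by exists (F k); split.
Qed.

End support.

(** A null open neighbourhood of [T x] would pull back to an open neighbourhood of [x], null by
    invariance. *)
Lemma supp_invariant (R : realType) (n : nat) (U : set 'rV[R]_n)
    (T : 'rV[R]_n -> 'rV[R]_n) (mu : probability (borelType R n) R) :
  open U -> (forall x, U x -> {for x, continuous T}) -> supp mu `<=` U ->
  invariant_measure U T mu -> set_fun (supp mu) (supp mu) T.
Proof.
move=> oU Tc suppU Tmu x sx; apply: contrapT => /notin_supp[Z [oZ ZTx Z0]].
move: (sx); apply/notin_supp; exists (U `&` T @^-1` Z); split => //.
- exact: open_setI_preimage.
- by split => //; exact: suppU.
- by rewrite -Z0; apply: Tmu; exact: open_borel.
Qed.

(** The image of [supp nu] is compact, hence closed. If [f x] missed it, the preimage of its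
    complement by [f] would be a neighbourhood of [x] whose measure equals that of the preimage by
    [g], which avoids [supp nu] and so is null. *)
Lemma supp_image_sub (R : realType) (n k : nat) (U : set 'rV[R]_n)
    (mu nu : probability (borelType R n) R) (f g : 'rV[R]_n -> 'rV[R]_k) :
  open U -> supp mu `<=` U -> supp nu `<=` U -> compact (supp nu) ->
  (forall x, U x -> {for x, continuous f}) ->
  (forall x, U x -> {for x, continuous g}) ->
  eq_borel (pushforward_on U mu f) (pushforward_on U nu g) ->
  f @` supp mu `<=` g @` supp nu.
Proof.
move=> oU muU nuU cnu fc gc fg _ [x sx <-]; apply: contrapT => nfx.
have ck : compact (g @` supp nu).
  apply: continuous_compact cnu.
  by apply: continuous_in_subspaceT => z /set_mem/nuU; exact: gc.
have oB : open (~` (g @` supp nu)).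
  by apply: closed_openC; apply: compact_closed ck; exact: norm_hausdorff.
have og : open (U `&` g @^-1` (~` (g @` supp nu))).
  exact: open_setI_preimage.
have oS : open (~` supp nu) by apply: closed_openC; exact: supp_closed.
have nu0 : nu (U `&` g @^-1` (~` (g @` supp nu))) = 0%E.
  apply: (subset_measure0 (open_borel og) (open_borel oS)).
    by move=> z [_ gz] sz; apply: gz; exists z.
  exact: measure_setC_supp.
move: (sx); apply/notin_supp; exists (U `&` f @^-1` (~` (g @` supp nu))); split.
- exact: open_setI_preimage.
- by split => //; exact: muU.
- by rewrite -nu0; apply: fg; exact: open_borel.
Qed.

(** For an open [Q] around [h x], the image by [g] of the part of [B] outside [Q] is compact, hence
    closed, and by injectivity misses [f x]. So [f] misses it near [x], which forces [h] into
    [Q]. *)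
Lemma continuous_factor (X Y Z : topologicalType) (A : set X) (B : set Y)
    (f : X -> Z) (g : Y -> Z) (h : X -> Y) :
  hausdorff_space Z -> compact B -> set_fun A B h ->
  {within A, continuous f} -> {within B, continuous g} ->
  {in B &, injective g} -> (forall x, A x -> g (h x) = f x) ->
  {within A, continuous h}.
Proof.
move=> hZ cB AB fc gc ginj gh.
apply/subspace_continuousP => x Ax W; rewrite nbhsE => -[Q [oQ Qhx] QW].
have cK : compact (g @` (B `&` ~` Q)).
  apply: continuous_compact; last first.
    by apply: compact_closedI => //; exact: open_closedC.
  by apply: continuous_subspaceW gc => y [].
have nfx : ~ (g @` (B `&` ~` Q)) (f x).
  move=> [y [By nQy]]; rewrite -gh// => /ginj E; apply: nQy.
  by rewrite E// ?inE//; exact: AB.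
have oC : open (~` (g @` (B `&` ~` Q))).
  by apply: closed_openC; exact: compact_closed hZ cK.
have := (subspace_continuousP A f).1 fc x Ax _ (open_nbhs_nbhs (conj oC nfx)).
rewrite /nbhs/= /within/=; apply: filterS => z /= zC Az; apply: QW.
apply: contrapT => nQhz; apply: (zC Az).
by exists (h z); [split => //; exact: AB|exact: gh].
Qed.

(** Dropping the last coordinate leaves the delay vector of the point, dropping the first that of
    its successor. *)
Lemma delay_mapS_eq (R : realType) (n m : nat) (y : 'rV[R]_n -> R)
    (T S : 'rV[R]_n -> 'rV[R]_n) (x z : 'rV[R]_n) :
  delay_map m.+1 y T x = delay_map m.+1 y S z ->
  delay_map m y T x = delay_map m y S z /\
  delay_map m y T (T x) = delay_map m y S (S z).
Proof.
move=> /rowP xz; split; apply/rowP => i; rewrite !mxE.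
  by have := xz (widen_ord (leqnSn m) i); rewrite !mxE.
by have := xz (lift ord0 i); rewrite !mxE lift0 !iterSr.
Qed.

Lemma delay_conjugate (R : realType) (n m : nat) (U : set 'rV[R]_n)
    (T S : 'rV[R]_n -> 'rV[R]_n) (mu nu : probability (borelType R n) R)
    (y : 'rV[R]_n -> R) :
  open U -> set_fun U U T -> set_fun U U S ->
  (forall x, U x -> {for x, continuous T}) ->
  (forall x, U x -> {for x, continuous S}) ->
  (forall x, U x -> {for x, continuous y}) ->
  invariant_measure U T mu -> invariant_measure U S nu ->
  supp mu `<=` U -> compact (supp mu) -> supp nu `<=` U -> compact (supp nu) ->
  (forall x z, supp mu x -> supp mu z ->
    delay_map m y T x = delay_map m y T z -> x = z) ->
  (forall x z, supp nu x -> supp nu z ->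
    delay_map m y S x = delay_map m y S z -> x = z) ->
  eq_borel (delay_measure m.+1 U mu y T) (delay_measure m.+1 U nu y S) ->
  topologically_conjugate (supp mu) T (supp nu) S.
Proof.
move=> oU TU SU Tc Sc yc Tmu Snu muU cmu nuU cnu injT injS munu.
have Tsupp : set_fun (supp mu) (supp mu) T := supp_invariant oU Tc muU Tmu.
have Ssupp : set_fun (supp nu) (supp nu) S := supp_invariant oU Sc nuU Snu.
have contT k x : U x -> {for x, continuous (delay_map k y T)}.
  exact: delay_map_continuous.
have contS k x : U x -> {for x, continuous (delay_map k y S)}.
  exact: delay_map_continuous.
have subTS := supp_image_sub oU muU nuU cnu (contT m.+1) (contS m.+1) munu.
have numu : eq_borel (delay_measure m.+1 U nu y S) (delay_measure m.+1 U mu y T).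
  by move=> C mC; rewrite munu.
have subST := supp_image_sub oU nuU muU cmu (contS m.+1) (contT m.+1) numu.
(* [h] matches points with the same [m.+1] delay coordinates; outside the support its value is
   arbitrary. *)
have /choice[h hP] : forall x, exists z, supp mu x -> supp nu z /\
    delay_map m.+1 y T x = delay_map m.+1 y S z.
  move=> x; have [sx|nsx] := pselect (supp mu x); last by exists x.
  have [z sz zx] := subTS _ (imageP _ sx).
  by exists z => _; split => //; rewrite zx.
have /choice[h' hP'] : forall z, exists x, supp nu z -> supp mu x /\
    delay_map m.+1 y S z = delay_map m.+1 y T x.
  move=> z; have [sz|nsz] := pselect (supp nu z); last by exists z.
  have [x sx xz] := subST _ (imageP _ sz).
  by exists x => _; split => //; rewrite xz.
have hsupp : set_fun (supp mu) (supp nu) h by move=> x /hP[].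
have hsupp' : set_fun (supp nu) (supp mu) h' by move=> x /hP'[].
have hE x : supp mu x -> delay_map m y S (h x) = delay_map m y T x.
  by move=> /hP[_ /delay_mapS_eq[]].
have hE' x : supp nu x -> delay_map m y T (h' x) = delay_map m y S x.
  by move=> /hP'[_ /delay_mapS_eq[]].
(* Both sides have the [m]-delay vector of [T x], and the delay map is injective on [supp nu]. *)
have hS x : supp mu x -> h (T x) = S (h x).
  move=> sx; have [sh /delay_mapS_eq[_ E]] := hP x sx.
  have sT := Tsupp _ sx.
  by apply: (injS _ _ (hsupp _ sT) (Ssupp _ sh)); rewrite (hE _ sT) E.
have hK z : supp nu z -> h (h' z) = z.
  move=> sz; have sh' := hsupp' _ sz; have shh' := hsupp _ sh'.
  by apply: (injS _ _ shh' sz); rewrite (hE _ sh') (hE' _ sz).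
have withinT : {within supp mu, continuous (delay_map m y T)}.
  by apply: continuous_in_subspaceT => x /set_mem/muU; exact: contT.
have withinS : {within supp nu, continuous (delay_map m y S)}.
  by apply: continuous_in_subspaceT => x /set_mem/nuU; exact: contS.
split => //; exists h, h'; split.
- split => // x sx; have sh := hsupp _ sx; have shh := hsupp' _ sh.
  by apply: (injT _ _ shh sx); rewrite (hE' _ sh) (hE _ sx).
- apply: (continuous_factor _ cnu hsupp withinT withinS _ hE).
    exact: norm_hausdorff.
  by move=> x z /set_mem sx /set_mem sz; exact: injS.
- apply: (continuous_factor _ cmu hsupp' withinS withinT _ hE').
    exact: norm_hausdorff.
  by move=> x z /set_mem sx /set_mem sz; exact: injT.
- by move=> z sz; have sh' := hsupp' _ sz; rewrite (hS _ sh') (hK _ sz).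
Qed.

(** * From null sets of parameters to prevalence *)

Lemma diffeomorphism_continuous (R : realType) (n : nat) (U : set 'rV[R]_n)
    (T : 'rV[R]_n -> 'rV[R]_n) x :
  diffeomorphism U T -> U x -> {for x, continuous T}.
Proof.
by move=> [T' [_ _ _ [Td _] _]] Ux; apply: differentiable_continuous; exact: Td.
Qed.

Lemma delay_not_injective_null (R : realType) (n m D : nat) (U : set 'rV[R]_n)
    (T : 'rV[R]_n -> 'rV[R]_n) (mu : probability (borelType R n) R) (d : R)
    (e : 'I_D -> C1 U) (v : C1 U) :
  open U -> diffeomorphism U T -> invariant_measure U T mu ->
  supp mu `<=` U -> compact (supp mu) -> has_boxdim (supp mu) d ->
  2 * d < m%:R -> periodic_point_condition T (supp mu) m ->
  interpolates U (2 * m) (fun a => C1_val (e a)) ->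
  lebesgue_null [set t : 'rV[R]_D | ~ forall x z, supp mu x -> supp mu z ->
    delay_map m (v + \sum_i t ord0 i *: e i : C1 U) T x =
    delay_map m (v + \sum_i t ord0 i *: e i : C1 U) T z -> x = z].
Proof.
move=> oU Td Tmu muU cmu dimd dm per einterp.
have Tc x : U x -> {for x, continuous T} by exact: diffeomorphism_continuous.
have Tsupp := supp_invariant oU Tc muU Tmu.
have [T' [[TU _] T'K _ TC1 _]] := Td.
have Tinj u w : supp mu u -> supp mu w -> T u = T w -> u = w.
  by move=> /muU Uu /muU Uw Tuw; rewrite -(T'K _ Uu) Tuw T'K.
have Tlip := C1_self_lipschitz_on oU TC1 muU cmu.
have C1lip (f : C1 U) : lipschitz_on (supp mu) f.
  by have /asboolP[fC _] := C1_valP f; exact: C1_lipschitz_on oU fC muU cmu.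
have [B [_ /(_ (B + 1))muB]] := compact_bounded cmu.
have {}muB x : supp mu x -> `|x| <= B + 1 by apply: muB; rewrite ltrDl.
have per' p : (1 <= p <= m)%N -> exists2 dp : R,
    has_boxdim (periodic_points T (supp mu) p) dp & dp < p%:R / 2.
  by move=> /per[].
have := delay_injective_null muU Tsupp Tinj Tlip (C1lip v)
  (fun a => C1lip (e a)) einterp muB dimd dm per'.
apply: lebesgue_null_sub => t tinj; apply: contra_not tinj => tinj x z sx sz.
have E : (v + \sum_i t ord0 i *: e i : C1 U) =
    (fun u => v u + \sum_a t ord0 a * e a u) :> ('rV[R]_n -> R).
  by apply/funext => u; rewrite -C1_sumE.
by rewrite E; exact: tinj.
Qed.

Theorem theorem5p1 (R : realType) (n : nat) (U : set 'rV[R]_n)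
  (T S : 'rV[R]_n -> 'rV[R]_n)
  (mu nu : probability (borelType R n) R)
  (dmu dnu : R) (m : nat) :
  open U ->
  diffeomorphism U T -> diffeomorphism U S ->
  mu U = 1%E -> nu U = 1%E ->
  invariant_measure U T mu -> invariant_measure U S nu ->
  supp mu `<=` U -> compact (supp mu) ->
  supp nu `<=` U -> compact (supp nu) ->
  has_boxdim (supp mu) dmu -> has_boxdim (supp nu) dnu ->
  2 * Num.max dmu dnu < m%:R ->
  periodic_point_condition T (supp mu) m ->
  periodic_point_condition S (supp nu) m ->
  almost_every (fun y : C1 U =>
    eq_borel (delay_measure m.+1 U mu y T) (delay_measure m.+1 U nu y S) ->
    topologically_conjugate (supp mu) T (supp nu) S).
Proof.
move=> oU Td Sd muU1 _ Tmu Snu muU cmu nuU cnu dimmu dimnu dm perT perS.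
have Tc x : U x -> {for x, continuous T} by exact: diffeomorphism_continuous.
have Sc x : U x -> {for x, continuous S} by exact: diffeomorphism_continuous.
have Tsupp := supp_invariant oU Tc muU Tmu.
have Ssupp := supp_invariant oU Sc nuU Snu.
have [_ [[TU _] _ _ _ _]] := Td; have [_ [[SU _] _ _ _ _]] := Sd.
(* The interpolation nodes of the probe must be placed in [U]. *)
have U0 : U !=set0.
  apply/set0P/eqP => U0; move/eqP: muU1.
  by rewrite U0 measure0 eq_sym onee_eq0.
have dmum : 2 * dmu < m%:R.
  by apply: le_lt_trans dm; rewrite ler_pM2l// le_max lexx.
have dnum : 2 * dnu < m%:R.
  by apply: le_lt_trans dm; rewrite ler_pM2l// le_max lexx orbT.
pose GT := [set y : C1 U | forall x z, supp mu x -> supp mu z ->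
  delay_map m y T x = delay_map m y T z -> x = z].
pose GS := [set y : C1 U | forall x z, supp nu x -> supp nu z ->
  delay_map m y S x = delay_map m y S z -> x = z].
exists (GT `&` GS); last first.
  move=> y [GTy GSy]; apply: (@delay_conjugate _ _ m U) => //.
  by move=> x; exact: C1_continuous.
split.
  have [s0 sC sU] := @smallest_sigma_algebra _ [set: C1 U] open.
  (* The intersection is that of the sequence [GT], [GS], [GS], ..., in terms of complements and a
     countable union. *)
  rewrite (_ : _ `&` _ =
      setT `\` \bigcup_k (setT `\` (if k == 0%N then GT else GS))); last first.
    rewrite setTD setC_bigcup; apply/seteqP; split=> y.
      by move=> [GTy GSy] k _; rewrite setTD setCK; case: ifP.
    move=> Gy; split; first by have := Gy 0%N I; rewrite setTD setCK.
    by have := Gy 1%N I; rewrite setTD setCK.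
  apply: (sC); apply: sU => k; apply: (sC).
  by case: ifP => _; exact: delay_injective_borel.
(* Two orbit segments of length [m] have at most [2 * m] points; the same probe serves both
   systems. *)
have [D [e [efree einterp]]] := interpolating_probe (2 * m) oU U0.
exists D, e; split => // v.
apply: (lebesgue_null_sub _ (lebesgue_nullU
  (delay_not_injective_null v oU Td Tmu muU cmu dimmu dmum perT einterp)
  (delay_not_injective_null v oU Sd Snu nuU cnu dimnu dnum perS einterp))).
by move=> t /= /not_andP.
Qed.
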